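(* Let $L:\mathbb{R}^n\times\mathbb{R}^n\to\mathbb{R}$ be a continuous Lagrangian (the Legendre transform of a Hamiltonian $H$ as in the context) such that: (a) $v\mapsto L(x,v)$ is convex for each $x\in\mathbb{R}^n$; (b) there are positive constants $A,B$ with $A^{-1}|v|^2-B\le L(x,v)\le A|v|^2+B$ for all $(x,v)\in\mathbb{R}^n\times\mathbb{R}^n$; (c) $(x,v)\mapsto L(x,v)$ is continuously differentiable on $\mathbb{R}^n\times\mathbb{R}^n$. Then for each $x\in\mathbb{R}^n$ there exists $\eta\in\mathcal{A}_x$ such that $J[x,\eta]=u(x)$ and $\left\Vert e^{-s/2}\dot\eta(s)\right\Vert_{L^2(0,\infty)}\le C_4$, where $C_4$ depends only on $C_H,A,B$.
   Context: Standing setting: $H:\mathbb{R}^n\times\mathbb{R}^n\to\mathbb{R}$ is continuous, bounded below ($H\ge -C_1$), $\sup_x|H(x,0)|\le C_2$, $p\mapsto H(x,p)$ is convex for each $x$, $\lim_{|p|\to\infty}\inf_x H(x,p)/|p|=+\infty$, and for every $R>0$ there is a nondecreasing $\omega_R:[0,\infty)\to[0,\infty)$ with $\omega_R(0^+)=0$ such that $|H(x,p)-H(y,p)|\le\omega_R(|x-y|)$ and $|H(x,p)-H(x,q)|\le\omega_R(|p-q|)$ for all $x,y$ and $|p|,|q|\le R$. The Lagrangian is $L(x,v)=\sup_{p\in\mathbb{R}^n}\{p\cdot v-H(x,p)\}$. For $x\in\mathbb{R}^n$, $\mathcal{A}_x=\{\eta\in\mathrm{AC}([0,\infty);\mathbb{R}^n):\eta(0)=x\}$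 (absolutely continuous curves), $J[x,\eta]=\int_0^\infty e^{-s}L(\eta(s),-\dot\eta(s))\,ds$, and $u(x)=\inf_{\eta\in\mathcal{A}_x}J[x,\eta]$. The function $u$ is bounded and Lipschitz, and $C_H>0$ denotes a constant, depending only on $H$, with $\|u\|_{L^\infty(\mathbb{R}^n)}+\|Du\|_{L^\infty(\mathbb{R}^n)}\le C_H$. *)

(* Defs.v *)
From HB Require Import structures.
From mathcomp Require Import all_boot all_order all_algebra.
From mathcomp Require Import all_classical all_reals all_analysis.

Set Implicit Arguments.
Unset Strict Implicit.
Unset Printing Implicit Defensive.

Import Order.TTheory GRing.Theory Num.Theory.
Import numFieldNormedType.Exports.

Local Open Scope classical_set_scope.
Local Open Scope ring_scope.

Section euclidean_space.
Context {R : realType} {n : nat}.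

(* R^n is 'rV[R]_n.  The library norm `|x| on 'rV[R]_n is the sup norm, hence
   the separate Euclidean norm; both induce the same topology. *)
Definition dot (p v : 'rV[R]_n) : R := \sum_(i < n) p 0 i * v 0 i.

Definition enorm (v : 'rV[R]_n) : R := Num.sqrt (dot v v).

(* Sets of n-dimensional Lebesgue measure zero, by countable covers with closed
   boxes (the library measure lebesgue_measure lives on R only).  The index set
   D lets a cover be finite or empty, which matters for n = 0. *)
Definition lebesgue_null (A : set 'rV[R]_n) :=
  forall e : R, 0 < e ->
  exists (D : set nat) (a b : nat -> 'rV[R]_n),
    [/\ forall k i, a k 0 i <= b k 0 i,
        A `<=` \bigcup_(k in D) [set x | forall i, a k 0 i <= x 0 i <= b k 0 i]
      & (\esum_(k in D) (\prod_(i < n) (b k 0 i - a k 0 i))%:E <= e%:E)%E].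

(* The L^oo(R^n) norm, as the essential supremum of |f|. *)
Definition Linfty_norm (f : 'rV[R]_n -> R) : \bar R :=
  ereal_inf [set M | lebesgue_null [set x | (M < `|f x|%:E)%E]].

(* The partial derivatives take a default value where they do not exist; for a
   Lipschitz f this happens on a null set only, which Linfty_norm ignores. *)
Definition gradient (f : 'rV[R]_n -> R) (x : 'rV[R]_n) : 'rV[R]_n :=
  \row_(i < n) 'D_(delta_mx 0 i) f x.

(* C^1 on R^n x R^n: differentiable, with continuous differential.  The space
   being finite dimensional, continuity of z |-> 'd g z is continuity in each
   direction w. *)
Definition continuously_differentiable (f : 'rV[R]_n -> 'rV[R]_n -> R) :=
  let g := fun z : 'rV[R]_n * 'rV[R]_n => f z.1 z.2 in
  (forall z, differentiable g z) /\
  (forall w, continuous (fun z => 'd g z w)).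

Definition abs_continuous_on (a b : R) (f : R -> 'rV[R]_n) :=
  forall e : R, 0 < e -> exists2 d : R, 0 < d &
  forall (m : nat) (l r : 'I_m -> R),
    (forall i, [/\ a <= l i, l i <= r i & r i <= b]) ->
    trivIset [set: 'I_m] (fun i => `]l i, r i[%classic) ->
    \sum_(i < m) (r i - l i) < d ->
    \sum_(i < m) enorm (f (r i) - f (l i)) < e.

(* AC([0, oo); R^n), in the usual sense: absolutely continuous on each compact
   subinterval.  The values of f at negative times are irrelevant. *)
Definition abs_continuous (f : R -> 'rV[R]_n) :=
  forall T : R, 0 < T -> abs_continuous_on 0 T f.

End euclidean_space.

Section hamilton_jacobi.
Context {R : realType} {n : nat}.
Implicit Types H L : 'rV[R]_n -> 'rV[R]_n -> R.

Definition superlinear H :=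
  forall M : R, exists r : R, forall p, r < enorm p ->
    (M%:E <= ereal_inf [set (H x p / enorm p)%:E | x in [set: 'rV[R]_n]])%E.

Definition has_modulus H (r : R) (w : R -> R) :=
  [/\ forall s, 0 <= s -> 0 <= w s,
      forall s t, 0 <= s -> s <= t -> w s <= w t,
      w s @[s --> 0^'+] --> 0,
      forall x y p, enorm p <= r -> `|H x p - H y p| <= w (enorm (x - y))
    & forall x p q, enorm p <= r -> enorm q <= r ->
        `|H x p - H x q| <= w (enorm (p - q))].

Record hamiltonian H : Prop := Hamiltonian {
  hamiltonian_continuous :
    continuous (fun z : 'rV[R]_n * 'rV[R]_n => H z.1 z.2);
  hamiltonian_bounded_below : exists C1, forall x p, - C1 <= H x p;
  hamiltonian_bounded0 : exists C2, forall x, `|H x 0| <= C2;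
  hamiltonian_convex : forall x, convex_function setT (H x);
  hamiltonian_superlinear : superlinear H;
  hamiltonian_modulus : forall r, 0 < r -> exists w, has_modulus H r w }.

Definition legendre H (x v : 'rV[R]_n) : \bar R :=
  ereal_sup [set (dot p v - H x p)%:E | p in [set: 'rV[R]_n]].

Definition admissible (x : 'rV[R]_n) : set (R -> 'rV[R]_n) :=
  [set eta | abs_continuous eta /\ eta 0 = x].

(* J[x, eta] for eta in A_x.  For L bounded below the integral is well defined
   in ]-oo, +oo]. *)
Definition action L (eta : R -> 'rV[R]_n) : \bar R :=
  (\int[lebesgue_measure]_(s in `]0%R, +oo[)
     (expR (- s) * L (eta s) (- derive1 eta s))%:E)%E.

(* The infimum is finite when L is bounded below: the constant curve has finite
   action, and every action is at least inf L. *)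
Definition value L (x : 'rV[R]_n) : R :=
  fine (ereal_inf [set action L eta | eta in admissible x]).

(* The norm of e^{-s/2} eta'(s) in L^2((0, oo); R^n). *)
Definition weighted_speed (eta : R -> 'rV[R]_n) : \bar R :=
  'N[lebesgue_measure]_(2%:E)
    [EFin \o (fun s => expR (- s / 2) * enorm (derive1 eta s)) \_ `]0, +oo[].

End hamilton_jacobi.

(* Main.v *)
(** Direct method. The constant curve gives u(x) <= B. Along a minimizing
    sequence, w_k(s) = e^{-s} (L(eta_k, -eta_k') + B) >= 0 has bounded integral, and
    quadratic growth gives, for a < b and every vector p,
      -p.(eta_k(b) - eta_k(a)) <= e^b \int_a^b w_k + A |p|^2 (b - a) / 4,
    which makes the eta_k equicontinuous. Limits are taken along an ultrafilter on
    the naturals, so no subsequence is extracted: eta is the pointwise limit of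
    the eta_k and Phi(a, b) that of \int_a^b w_k; the displayed bound passes to
    the limit and yields the absolute continuity of eta. For lower semicontinuity,
    Fenchel's inequality with a constant p on a short interval ]a, b] around s gives
      Phi(a, b) >= e^{-b} (-p.(eta(b) - eta(a)) - (b - a) (H(eta(s), p) + o(1) - B)).
    Dividing by b - a, at each s where eta is differentiable the dyadic averages of
    Phi are asymptotically at least e^{-s} (L(eta, -eta') + B), and Fatou's lemma
    concludes.

    The argument needs the fundamental theorem of calculus for an absolutely
    continuous function f. The integrals over a set E of the dyadic difference
    quotients of f are uniformly small when E is; their ultrafilter limit is thus a
    charge dominated by the Lebesgue measure, whose Radon-Nikodym density is f'. *)

Require Import Defs.
From HB Require Import structures.
From mathcomp Require Import all_boot all_order all_algebra.
From mathcomp Require Import all_classical all_reals all_analysis.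
From mathcomp Require Import measurable_realfun ring lra.

Import Order.TTheory GRing.Theory Num.Theory.
Import numFieldNormedType.Exports.
Local Open Scope classical_set_scope.
Local Open Scope ring_scope.

(** * The fundamental theorem of calculus for absolutely continuous functions *)

Lemma ultra_fmap (S T : Type) (u : S -> T) (U : set_system S) :
  UltraFilter U -> UltraFilter (u @ U).
Proof.
move=> UU; split; first exact: fmap_proper_filter.
move=> G PG UG; rewrite predeqE => A; split; last exact: UG.
move=> GA; have [//|UnA] := in_ultra_setVsetC (u @^-1` A) UU.
have /filterI/(_ GA) : G (~` A) by apply: UG.
by rewrite setICl => /filter_not_empty.
Qed.

(** Compactness of [[- C, C]]: the image ultrafilter converges to one of its points. Every limit in
    the proof is taken this way, in place of extracting subsequences. *)
Lemma ultra_cvg_lim {R : realType} {T : Type} {U : set_system T} (u : T -> R) (C : R) :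
  UltraFilter U -> (\forall k \near U, `|u k| <= C) ->
  u @ U --> lim (u @ U).
Proof.
move=> UU uC; have := @segment_compact R (- C) C.
rewrite compact_ultra => /(_ _ (ultra_fmap _ _ u U UU)) [|p [_ /= up]].
  by apply: filterS uC => k; rewrite /= in_itv/= ler_norml.
by apply/cvg_ex; exists p.
Qed.

Section dyadic.
Context {R : realType}.
Implicit Types (T : R) (f : R -> R).
Local Notation mu := (@lebesgue_measure R).

Definition real_abs_continuous_on (a b : R) f :=
  forall e : R, 0 < e -> exists2 d : R, 0 < d &
  forall (m : nat) (l r : 'I_m -> R),
    (forall i, [/\ a <= l i, l i <= r i & r i <= b]) ->
    trivIset [set: 'I_m] (fun i => `]l i, r i[%classic) ->
    \sum_(i < m) (r i - l i) < d ->
    \sum_(i < m) `|f (r i) - f (l i)| < e.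

Definition dyadic T (m j : nat) : R := T / 2 ^+ m * j%:R.

(** Half-open on the left, so that the cells with [j < 2 ^ m] partition []0, T]] exactly and no
    endpoint needs care. *)
Definition dyadic_cell T m j : set R := `]dyadic T m j, dyadic T m j.+1]%classic.

Lemma dyadicS T m j : dyadic T m j.+1 = dyadic T m j + T / 2 ^+ m.
Proof. by rewrite /dyadic -[in LHS](@natr1 _ j) mulrDr mulr1. Qed.

Lemma dyadic_ge0 T m j : 0 <= T -> 0 <= dyadic T m j.
Proof. by move=> T0; rewrite mulr_ge0// divr_ge0// exprn_ge0. Qed.

Lemma le_dyadic T m i j : 0 <= T -> (i <= j)%N -> dyadic T m i <= dyadic T m j.
Proof.
by move=> T0 ij; rewrite ler_wpM2l ?ler_nat// divr_ge0// exprn_ge0.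
Qed.

Lemma dyadic_last T m : dyadic T m (2 ^ m) = T.
Proof. by rewrite /dyadic natrX divfK// expf_neq0. Qed.

Lemma dyadic_le T m j : 0 <= T -> (j <= 2 ^ m)%N -> dyadic T m j <= T.
Proof. by move=> T0 jm; rewrite -[leRHS](dyadic_last T m) le_dyadic. Qed.

Lemma trivIset_dyadic_cell T m : 0 <= T -> trivIset setT (dyadic_cell T m).
Proof.
move=> T0; apply/trivIsetP => i j _ _.
wlog ij : i j / (i < j)%N => [H|_].
  rewrite neq_ltn => /orP[] ij; first by apply: H; rewrite // ltn_eqF.
  by rewrite setIC; apply: H; rewrite // ltn_eqF.
rewrite -subset0 => x []; rewrite /dyadic_cell /= !in_itv/= => /andP[_ xi] /andP[jx _].
by have := lt_le_trans jx xi; rewrite ltNge le_dyadic.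
Qed.

Lemma measurable_dyadic_cell T m j : measurable (dyadic_cell T m j).
Proof. exact: measurable_itv. Qed.

Lemma lebesgue_dyadic_cell T m j : 0 <= T -> mu (dyadic_cell T m j) = (T / 2 ^+ m)%:E.
Proof.
move=> T0; rewrite /dyadic_cell lebesgue_measure_itv/= lte_fin dyadicS ltrDl.
case: ifPn => [_|]; first by rewrite -EFinB addrAC subrr add0r.
rewrite -leNgt => T0'; congr EFin; apply/eqP; rewrite eq_le T0' andbT.
by rewrite divr_ge0// exprn_ge0.
Qed.

(* A subfamily S of the dyadic intervals is encoded by degenerating the
   intervals outside S. *)
Lemma ac_dyadic_subfamily T f e : 0 <= T -> real_abs_continuous_on 0 T f -> 0 < e ->
  exists2 d : R, 0 < d & forall m (S : pred nat),
    \sum_(j < 2 ^ m | S j) T / 2 ^+ m < d ->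
    \sum_(j < 2 ^ m | S j) `|f (dyadic T m j.+1) - f (dyadic T m j)| < e.
Proof.
move=> T0 acf e0; have [d d0 H] := acf e e0; exists d => // m S Sd.
have := H (2 ^ m)%N (fun j => dyadic T m j)
  (fun j => if S j then dyadic T m j.+1 else dyadic T m j).
have h0 : 0 <= T / 2 ^+ m by rewrite divr_ge0// exprn_ge0.
rewrite [X in _ -> X < e]big_mkcond/=.
rewrite [X in _ -> X < e](eq_bigr (fun j : 'I_(2 ^ m) =>
  `|f (if S j then dyadic T m j.+1 else dyadic T m j) - f (dyadic T m j)|));
  last by move=> j _; case: ifP => // _; rewrite subrr normr0.
apply.
- move=> j; split; first exact: dyadic_ge0.
  + by case: ifP => //; rewrite dyadicS lerDl.
  + by case: ifP => _; apply: dyadic_le => //; exact: ltnW.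
- apply/trivIsetP => i j _ _ ij.
  have /trivIsetP/(_ i j I I) := trivIset_dyadic_cell T m T0.
  move=> /(_ ij); rewrite -!subset0 /dyadic_cell => dis x [] /=; rewrite !in_itv/=.
  move=> xi xj; apply: (dis x); split => /=; rewrite in_itv/=.
  + case: ifP xi => _ /andP[-> xi] /=; first exact: ltW.
    by rewrite (le_trans (ltW xi))// le_dyadic.
  + case: ifP xj => _ /andP[-> xj] /=; first exact: ltW.
    by rewrite (le_trans (ltW xj))// le_dyadic.
- rewrite (le_lt_trans _ Sd)// [leRHS]big_mkcond/=; apply: ler_sum => j _.
  by case: ifP => _; rewrite ?subrr// dyadicS addrAC subrr add0r.
Qed.

End dyadic.

Lemma sum_measure_le {d} {X : measurableType d} {R : realType}
    (mu : {measure set X -> \bar R}) (n : nat) (F : 'I_n -> set X) (A : set X) :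
  measurable A -> (forall i, measurable (F i)) -> trivIset setT F ->
  (forall i, F i `<=` A) -> (\sum_(i < n) mu (F i) <= mu A)%E.
Proof.
move=> mA mF tF FA; rewrite -measure_bigsetU_ord//.
apply: le_measure; rewrite ?inE//; first exact: bigsetU_measurable.
by apply: (big_ind (fun B => B `<=` A)) => [|B C BA CA|i _]; rewrite ?sub0set ?subUset.
Qed.

Lemma exists_dyadic_lt {R : realType} (T d : R) : 0 < d ->
  exists m0 : nat, forall m, (m0 <= m)%N -> T / 2 ^+ m < d.
Proof.
move=> d0; have := @cvg_geometric R T 2^-1.
rewrite ger0_norm ?invr_ge0// invf_lt1 ?ltr0n// ltr1n => /(_ isT).
move=> /cvgrPdist_lt/(_ d d0)[m0 _ H]; exists m0 => m /H.
rewrite /geometric/= sub0r normrN exprVn; exact: le_lt_trans (ler_norm _).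
Qed.

(** * Integrals of dyadic difference quotients *)

Section dyadic_charge.
Context {R : realType}.
Local Notation mu := (@lebesgue_measure R).
Variables (T : R) (f : R -> R).
Hypothesis T0 : 0 < T.
Hypothesis acf : real_abs_continuous_on 0 T f.

(** The fraction of the cell that [E] occupies. *)
Definition dyadic_weight m j (E : set R) : R :=
  fine (mu (E `&` dyadic_cell T m j)) / (T / 2 ^+ m).

(** The integral over [E] of the step function whose value on each cell is the difference quotient
    of [f] between the ends of the cell. *)
Definition dyadic_sum m (E : set R) : R :=
  \sum_(j < 2 ^ m) (f (dyadic T m j.+1) - f (dyadic T m j)) * dyadic_weight m j E.

Let h0 m : 0 < T / 2 ^+ m. Proof. by rewrite divr_gt0// exprn_gt0. Qed.

Lemma measurable_dyadic_piece m j E : measurable E ->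
  measurable (E `&` dyadic_cell T m j).
Proof. by move=> mE; apply: measurableI => //; exact: measurable_dyadic_cell. Qed.
Local Hint Resolve measurable_dyadic_piece : core.

Lemma dyadic_piece_le m j E : measurable E ->
  (mu (E `&` dyadic_cell T m j) <= (T / 2 ^+ m)%:E)%E.
Proof.
move=> mE; rewrite -(lebesgue_dyadic_cell T m j (ltW T0)).
by apply: le_measure; rewrite ?inE;
  [exact: measurable_dyadic_piece|exact: measurable_dyadic_cell|exact: subIsetr].
Qed.

Lemma dyadic_piece_fin m j E : measurable E ->
  mu (E `&` dyadic_cell T m j) \is a fin_num.
Proof.
move=> mE; rewrite ge0_fin_numE//.
exact: le_lt_trans (dyadic_piece_le m j E mE) (ltry _).
Qed.
Local Hint Resolve dyadic_piece_fin : core.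

Lemma dyadic_weight_ge0 m j E : 0 <= dyadic_weight m j E.
Proof. by rewrite divr_ge0 ?fine_ge0// ltW. Qed.

Lemma dyadic_weight_le1 m j E : measurable E -> dyadic_weight m j E <= 1.
Proof.
move=> mE; rewrite ler_pdivrMr// mul1r -lee_fin fineK//; last exact: dyadic_piece_fin.
exact: dyadic_piece_le.
Qed.

Lemma dyadic_weightU m j E F : measurable E -> measurable F -> E `&` F = set0 ->
  dyadic_weight m j (E `|` F) = dyadic_weight m j E + dyadic_weight m j F.
Proof.
move=> mE mF EF0; rewrite /dyadic_weight setIUl measureU//.
- by rewrite fineD ?mulrDl//; exact: dyadic_piece_fin.
- exact: measurable_dyadic_piece.
- exact: measurable_dyadic_piece.
- by rewrite setIACA EF0 set0I.
Qed.

Lemma dyadic_sumU m E F : measurable E -> measurable F -> E `&` F = set0 ->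
  dyadic_sum m (E `|` F) = dyadic_sum m E + dyadic_sum m F.
Proof.
move=> mE mF EF0; rewrite /dyadic_sum -big_split/=; apply: eq_bigr => j _.
by rewrite dyadic_weightU// mulrDr.
Qed.

Lemma sum_dyadic_weight_le m E : measurable E ->
  ((\sum_(j < 2 ^ m) dyadic_weight m j E * (T / 2 ^+ m))%:E <= mu (E `&` `]0%R, T]))%E.
Proof.
move=> mE; rewrite -sumEFin.
rewrite (eq_bigr (fun j : 'I_(2 ^ m) => mu (E `&` dyadic_cell T m j))); last first.
  by move=> j _; rewrite divfK ?gt_eqF// fineK//; exact: dyadic_piece_fin.
apply: sum_measure_le => //.
- by apply: measurableI.
- by move=> i; exact: measurable_dyadic_piece.
- apply/trivIsetP => i j _ _ ij; rewrite setIACA setIid.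
  have /trivIsetP/(_ i j I I ij) := trivIset_dyadic_cell T m (ltW T0).
  by move=> ->; rewrite setI0.
- move=> j; apply: setIS => x; rewrite /dyadic_cell/= !in_itv/= => /andP[xj jx].
  apply/andP; split; first exact: le_lt_trans (dyadic_ge0 _ _ _ (ltW T0)) xj.
  exact: le_trans jx (dyadic_le _ _ _ (ltW T0) (ltn_ord j)).
Qed.

(** Absolute continuity with [e = 1] gives a length [d]. Once the cells of level [m0] are shorter
    than [d], the finer cells inside each of them contribute less than 1, and there are [2 ^ m0]
    such groups. *)
Lemma dyadic_variation_bounded : exists m0 C, forall m, (m0 <= m)%N ->
  \sum_(j < 2 ^ m) `|f (dyadic T m j.+1) - f (dyadic T m j)| <= C.
Proof.
have [d d0 H] := ac_dyadic_subfamily T f 1 (ltW T0) acf ltr01.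
have [m0 m0d] := exists_dyadic_lt T d d0.
exists m0, (2 ^ m0)%:R => m m0m.
have Em : (2 ^ m = 2 ^ m0 * 2 ^ (m - m0))%N by rewrite -expnD subnKC.
rewrite -(big_mkord xpredT (fun j => `|f (dyadic T m j.+1) - f (dyadic T m j)|)).
rewrite Em big_nat_mul.
rewrite -[leRHS]mulr_natr mul1r -[X in _ <= X%:R]subn0 -sumr_const_nat.
apply: ler_sum_nat => i /andP[_ im].
have iN : (i.+1 * 2 ^ (m - m0) <= 2 ^ m)%N by rewrite Em leq_mul2r im orbT.
(* A block of consecutive indices is written as a subfamily selected by a predicate, the form that
   [ac_dyadic_subfamily] takes. *)
have block (F : nat -> R) : \sum_(i * 2 ^ (m - m0) <= j < i.+1 * 2 ^ (m - m0)) F j =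
    \sum_(j < 2 ^ m | (i * 2 ^ (m - m0) <= j < i.+1 * 2 ^ (m - m0))%N) F j.
  rewrite (big_nat_widen _ _ _ _ _ iN) (big_nat_widenl _ 0%N)// big_mkord.
  by apply: eq_bigl => j /=; rewrite andbC.
rewrite block; apply/ltW.
apply: (H m (fun j => (i * 2 ^ (m - m0) <= j < i.+1 * 2 ^ (m - m0))%N)).
rewrite -(block (fun=> T / 2 ^+ m)) sumr_const_nat -mulnBl subSnn mul1n.
rewrite (_ : _ *+ _ = T / 2 ^+ m0) ?m0d//.
have E2 : 2 ^+ m = 2 ^+ m0 * 2 ^+ (m - m0) :> R by rewrite -exprD subnKC.
by rewrite -mulr_natr natrX E2 invfM mulrA divfK// expf_neq0.
Qed.

(** The cells are split by whether [E] fills more than a fraction [th] of them. By Markov's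
    inequality the well-filled cells have total length below [d], so absolute continuity bounds
    their increments by [e / 2]. The other weights are at most [th], and the bounded variation [C]
    controls their sum. The estimate is uniform in the level [m]. *)
Lemma dyadic_sum_small : exists m0 : nat, forall e, 0 < e -> exists2 k : R, 0 < k &
  forall m E, (m0 <= m)%N -> measurable E -> (mu (E `&` `]0%R, T]) < k%:E)%E ->
  `|dyadic_sum m E| <= e.
Proof.
have [m0 [C HC]] := dyadic_variation_bounded.
exists m0 => e e0.
have C0 : 0 <= C by apply: le_trans (HC m0 (leqnn _)); exact: sumr_ge0.
have [d d0 H] := ac_dyadic_subfamily T f (e / 2) (ltW T0) acf ltac:(lra).
(* Chosen so that [C * th <= e / 2]; the [+ 1] keeps the denominator positive. *)
pose th := e / 2 / (C + 1).
have th0 : 0 < th by rewrite !divr_gt0//; lra.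
exists (th * d) => [|m E m0m mE]; first exact: mulr_gt0.
move=> /(le_lt_trans (sum_dyadic_weight_le m E mE)); rewrite lte_fin => Ek.
apply: le_trans (ler_norm_sum _ _ _) _.
under eq_bigr do rewrite normrM (ger0_norm (dyadic_weight_ge0 _ _ _)).
pose a (j : nat) := `|f (dyadic T m j.+1) - f (dyadic T m j)|.
pose w (j : nat) := dyadic_weight m j E.
rewrite (bigID (fun j : 'I__ => th < w j))/= [leRHS](splitr e) lerD//.
  apply: (@le_trans _ _ (\sum_(j < 2 ^ m | th < w j) a j)).
    by apply: ler_sum => j _; rewrite ler_piMr// dyadic_weight_le1.
  apply/ltW/(H m (fun j => th < w j)).
  rewrite -(ltr_pM2l th0) mulr_sumr (le_lt_trans _ Ek)//.
  rewrite [leRHS](bigID (fun j : 'I__ => th < w j))/= -[leLHS]addr0 lerD//.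
    by apply: ler_sum => j thw; rewrite ler_pM2r ?h0// ltW.
  by apply: sumr_ge0 => j _; rewrite mulr_ge0 ?dyadic_weight_ge0// ltW ?h0.
apply: (@le_trans _ _ (\sum_(j < 2 ^ m) a j * th)).
  rewrite [leRHS](bigID (fun j : 'I__ => th < w j))/= -[leLHS]add0r lerD//.
    by apply: sumr_ge0 => j _; rewrite mulr_ge0 ?normr_ge0 ?(ltW th0).
  by apply: ler_sum => j; rewrite -leNgt => thw; rewrite ler_wpM2l.
rewrite -mulr_suml /th mulrA ler_pdivrMr; last lra.
rewrite mulrC ler_wpM2l//; first lra.
by apply: (le_trans (HC m m0m)); lra.
Qed.

Lemma dyadic_sum_bounded : exists m0 C, forall m E, (m0 <= m)%N -> measurable E ->
  `|dyadic_sum m E| <= C.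
Proof.
have [m0 [C HC]] := dyadic_variation_bounded.
exists m0, C => m E m0m mE; apply: le_trans (HC m m0m).
apply: le_trans (ler_norm_sum _ _ _) _; apply: ler_sum => j _.
rewrite normrM (ger0_norm (dyadic_weight_ge0 _ _ _)).
by rewrite ler_piMr// dyadic_weight_le1.
Qed.

End dyadic_charge.

Lemma ac_uniform_continuous {R : realType} (a b : R) (f : R -> R) :
  real_abs_continuous_on a b f -> forall e, 0 < e -> exists2 d, 0 < d &
  forall x y, a <= x -> x <= y -> y <= b -> y - x < d -> `|f y - f x| < e.
Proof.
move=> acf e e0; have [d d0 H] := acf e e0; exists d => // x y ax xy yb xyd.
have := H 1%N (fun=> x) (fun=> y); rewrite !big_ord1; apply=> //.
by apply/trivIsetP => i j _ _; rewrite !ord1 eqxx.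
Qed.

(** * The limit charge *)

Section charge.
Context {R : realType}.
Local Notation mu := (@lebesgue_measure R).
Variables (T : R) (f : R -> R) (U : set_system nat).
Hypothesis T0 : 0 < T.
Hypothesis acf : real_abs_continuous_on 0 T f.
Hypothesis UU : UltraFilter U.
Hypothesis Uoo : \oo `<=` U.

Definition dyadic_limit (E : set R) : R := lim (dyadic_sum T f m E @[m --> U]).

Lemma dyadic_limit_cvg E : measurable E ->
  dyadic_sum T f m E @[m --> U] --> dyadic_limit E.
Proof.
move=> mE; have [m0 [C H]] := dyadic_sum_bounded T f T0 acf.
apply: (ultra_cvg_lim _ C); apply: Uoo; exists m0 => // m /= m0m.
exact: H.
Qed.

Lemma dyadic_limitU E F : measurable E -> measurable F -> E `&` F = set0 ->
  dyadic_limit (E `|` F) = dyadic_limit E + dyadic_limit F.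
Proof.
move=> mE mF EF0; apply: cvg_lim => //.
under eq_cvg do rewrite dyadic_sumU//.
by apply: cvgD; exact: dyadic_limit_cvg.
Qed.

(** The smallness is uniform in the level, hence survives the limit. Both domination by the Lebesgue
    measure and countable additivity follow from it. *)
Lemma dyadic_limit_small e : 0 < e -> exists2 k : R, 0 < k &
  forall E, measurable E -> (mu (E `&` `]0%R, T]) < k%:E)%E -> `|dyadic_limit E| <= e.
Proof.
move=> e0; have [m0 /(_ e e0)[k k0 H]] := dyadic_sum_small T f T0 acf.
exists k => // E mE Ek.
have /cvg_norm nE := dyadic_limit_cvg E mE.
rewrite -(cvg_lim _ nE)//; apply: limr_le; first by apply/cvg_ex; eexists; exact: nE.
by apply: Uoo; exists m0 => // m /= m0m; exact: H.
Qed.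

Lemma dyadic_limit_null E : measurable E -> mu E = 0%E -> dyadic_limit E = 0.
Proof.
move=> mE E0; apply/eqP; rewrite -normr_le0; apply/ler_addgt0Pl => e e0.
rewrite addr0; have [k k0 H] := dyadic_limit_small e e0; apply: H => //.
rewrite (@le_lt_trans _ _ 0%E)//.
rewrite -E0 le_measure ?inE//; first exact: measurableI.
Qed.

Lemma dyadic_limit_bigsetU (F : nat -> set R) n : (forall i, measurable (F i)) ->
  trivIset setT F ->
  dyadic_limit (\big[setU/set0]_(i < n) F i) = \sum_(i < n) dyadic_limit (F i).
Proof.
move=> mF tF; elim: n => [|n IHn].
  by rewrite !big_ord0 dyadic_limit_null ?measure0.
rewrite !big_ord_recr/= dyadic_limitU ?IHn//; first exact: bigsetU_measurable.
rewrite -bigcup_mkord -subset0 => x [[i /= ni Fi] Fn].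
by have /eqP := tF i n I I (ex_intro _ x (conj Fi Fn)); rewrite ltn_eqF.
Qed.

(** By finite additivity the error after [n] terms is the charge of the tail [G n]. The tails
    decrease to the empty set, so their measure in []0, T]] tends to 0 and [dyadic_limit_small]
    applies. *)
Lemma dyadic_limit_sigma_additive : semi_sigma_additive (EFin \o dyadic_limit).
Proof.
move=> F mF tF mUF; rewrite /=.
under eq_cvg do rewrite sumEFin big_mkord -dyadic_limit_bigsetU//.
apply/fine_cvgP; split; first by near=> n.
apply/cvgrPdist_le => e e0.
have [k k0 H] := dyadic_limit_small e e0.
pose G n := \bigcup_i F (n + i)%N.
have mG n : measurable (G n) by apply: bigcup_measurable => i _; exact: mF.
have GE n : dyadic_limit (\bigcup_i F i) =
    dyadic_limit (\big[setU/set0]_(i < n) F i) + dyadic_limit (G n).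
  rewrite (bigcup_splitn n) -/(G n) dyadic_limitU//; first exact: bigsetU_measurable.
  rewrite -bigcup_mkord -subset0 => x [[i /= ni Fi] [j _ Fj]].
  have /eqP := tF i (n + j)%N I I (ex_intro _ x (conj Fi Fj)).
  by rewrite ltn_eqF// ltn_addr.
have G0 : \bigcap_n (G n `&` `]0%R, T]) = set0.
  rewrite -subset0 => x Gx; have [[i _ Fi] _] := Gx 0%N I.
  have [[j _ Fj] _] := Gx i.+1 I.
  have /eqP := tF _ _ I I (ex_intro _ x (conj Fi Fj)).
  by rewrite add0n ltn_eqF// ltn_addr.
have : mu (G n `&` `]0%R, T]) @[n --> \oo] --> mu (\bigcap_n (G n `&` `]0%R, T])).
  apply: nonincreasing_cvg_mu.
  (* Continuity from above requires finite measure, which the intersection with []0, T]]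
     provides. *)
  - rewrite (@le_lt_trans _ _ (mu `]0%R, T]))//.
      by apply: le_measure; rewrite ?inE;
        [exact: measurableI|exact: measurable_itv|exact: subIsetr].
    by rewrite lebesgue_measure_itv/=; case: ifP => _; rewrite ?ltry// -EFinB ltry.
  - by move=> n; apply: measurableI; [exact: mG|exact: measurable_itv].
  - by rewrite G0.
  - move=> n m nm; apply/subsetPset; apply: setSI => x [i _ Fi].
    by exists (m - n + i)%N => //; rewrite addnA subnKC.
rewrite G0 measure0 => /fine_cvgP[fG /cvgrPdist_lt/(_ k k0) Gk].
near=> n.
rewrite (GE n) addrAC subrr add0r; apply: H => //.
have fn : mu (G n `&` `]0%R, T]) \is a fin_num by near: n.
rewrite -(fineK fn) lte_fin; apply: le_lt_trans (ler_norm _) _.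
by rewrite -normrN -[X in `|X|]add0r; near: n.
Unshelve. all: by end_near. Qed.

End charge.

Lemma derivable_cvg {R : numFieldType} {V : normedModType R} (f : R -> V) (x : R) :
  derivable f x 1 -> h^-1 *: (f (h + x) - f x) @[h --> 0^'] --> derive1 f x.
Proof.
rewrite /derivable /derive1.
by under eq_fun do rewrite /= [_%:A]mulr1.
Qed.

(** * The density of the charge and the derivative *)

Section density.
Context {R : realType}.
Local Notation mu := (@lebesgue_measure R).
Variables (T : R) (f : R -> R).
Hypothesis T0 : 0 < T.
Hypothesis acf : real_abs_continuous_on 0 T f.

(** Cells before the [J]-th lie in []0, x]], have weight 1 and telescope; later cells miss []0, x]].
    Only the cell at [x] is partly filled. *)
Lemma dyadic_sum_itv m x : 0 <= x -> x < T -> exists J : nat,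
  [/\ dyadic T m J <= x, x < dyadic T m J.+1, dyadic T m J.+1 <= T &
   dyadic_sum T f m `]0, x] = f (dyadic T m J) - f 0 +
     (f (dyadic T m J.+1) - f (dyadic T m J)) * dyadic_weight T m J `]0, x]].
Proof.
move=> x0 xT; have h0 : 0 < T / 2 ^+ m by rewrite divr_gt0// exprn_gt0.
(* Truncation places [x] in an interval closed on the left, unlike [dyadic_cell]. If [x] is its left
   end, the weight of cell [J] is 0 and the formula still holds. *)
pose J := Num.truncn (x / (T / 2 ^+ m)).
have /truncn_itv/andP[] : 0 <= x / (T / 2 ^+ m) by rewrite divr_ge0// ltW.
rewrite -/J ler_pdivlMr// ltr_pdivrMr// ![_ * (T / _)]mulrC -!/(dyadic T m _) => Jx xJ.
have JN : (J < 2 ^ m)%N.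
  rewrite ltnNge; apply/negP => /(le_dyadic T m _ _ (ltW T0)).
  by rewrite dyadic_last leNgt (le_lt_trans Jx).
exists J; split => //; first exact: dyadic_le (ltW T0) JN.
have wE j : dyadic_weight T m j `]0, x] =
    fine (mu (`]0, x] `&` dyadic_cell T m j)) / (T / 2 ^+ m) by [].
rewrite /dyadic_sum -(big_mkord xpredT (fun j =>
  (f (dyadic T m j.+1) - f (dyadic T m j)) * dyadic_weight T m j `]0, x])).
rewrite (big_cat_nat (n := J)) ?leq0n 1?ltnW//= [in X in _ + X]big_ltn//=.
rewrite [X in _ + (_ + X)]big1_seq ?addr0; last first.
  move=> j /andP[_]; rewrite mem_index_iota => /andP[Jj _].
  rewrite wE (_ : _ `&` _ = set0) ?measure0 ?mul0r ?mulr0//.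
  rewrite -subset0 => y []; rewrite /dyadic_cell/= !in_itv/= => /andP[_ yx] /andP[jy _].
  have := le_dyadic T m _ _ (ltW T0) Jj.
  by rewrite leNgt (lt_le_trans jy)// (le_trans yx)// ltW.
congr (_ + _).
rewrite (eq_big_nat _ _ (F2 := fun j => f (dyadic T m j.+1) - f (dyadic T m j))).
  by rewrite (telescope_sumr (fun j => f (dyadic T m j)))// {2}/dyadic mulr0.
move=> j /andP[_ jJ]; rewrite wE setIidr.
  by rewrite lebesgue_dyadic_cell ?(ltW T0)//= divff ?mulr1// gt_eqF.
move=> y; rewrite /dyadic_cell/= !in_itv/= => /andP[jy yj]; apply/andP; split.
  exact: le_lt_trans (dyadic_ge0 _ _ _ (ltW T0)) jy.
by rewrite (le_trans yj)// (le_trans _ Jx)// le_dyadic// ltW.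
Qed.

(** By [dyadic_sum_itv] the error consists of two increments of [f] over intervals no longer than
    the mesh; uniform continuity makes them vanish. *)
Lemma dyadic_limit_itv (U : set_system nat) x : UltraFilter U -> \oo `<=` U ->
  0 <= x -> x < T -> dyadic_limit T f U `]0, x] = f x - f 0.
Proof.
move=> UU Uoo x0 xT; apply: cvg_lim => //.
apply/cvgrPdist_le => e e0.
have [d d0 H] := ac_uniform_continuous 0 T f acf (e / 2) ltac:(lra).
have [m0 Hm0] := exists_dyadic_lt T d d0.
apply: Uoo; exists m0 => // m /= /Hm0 hd.
have [J [Jx xJ JT ->]] := dyadic_sum_itv m x x0 xT.
have -> : f x - f 0 - (f (dyadic T m J) - f 0 + (f (dyadic T m J.+1) - f (dyadic T m J)) *
    dyadic_weight T m J `]0, x]) = (f x - f (dyadic T m J)) -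
   (f (dyadic T m J.+1) - f (dyadic T m J)) * dyadic_weight T m J `]0, x] by ring.
apply: le_trans (ler_normB _ _) _; rewrite [leRHS]splitr lerD//.
  apply/ltW/H => //; [exact: dyadic_ge0 (ltW T0)|exact: ltW|].
  by rewrite (lt_trans _ hd)// ltrBlDl -dyadicS.
rewrite normrM (ger0_norm (dyadic_weight_ge0 _ T0 _ _ _)).
apply: (@le_trans _ _ `|f (dyadic T m J.+1) - f (dyadic T m J)|).
  by rewrite ler_piMr// dyadic_weight_le1.
apply/ltW/H => //; [exact: dyadic_ge0 (ltW T0)| |].
  by rewrite le_dyadic// ltW.
by rewrite dyadicS addrAC subrr add0r.
Qed.

(** [g] is the Radon-Nikodym density of the limit charge. Evaluating the charge on []0, x]] gives
    the integral formula, and Lebesgue differentiation ([FTC1]) then identifies [g] with the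
    derivative of [f] almost everywhere. *)
Lemma abs_continuous_density : exists g : R -> R,
  [/\ mu.-integrable setT (EFin \o g),
      forall x, 0 <= x -> x < T -> f x - f 0 = \int[mu]_(t in `]0, x]) g t
    & {ae mu, forall x, 0 < x < T -> h^-1 *: (f (h + x) - f x) @[h --> 0^'] --> g x}].
Proof.
have [U [UU Uoo]] := @ultraFilterLemma nat \oo _.
pose nu0 := EFin \o dyadic_limit T f U : set (measurableTypeR R) -> \bar R.
have nu00 : nu0 set0 = 0%E.
  by rewrite /nu0/= (dyadic_limit_null T f U)// measure0.
have nufin A : measurable A -> nu0 A \is a fin_num by [].
pose nu : {charge set (measurableTypeR R) -> \bar R} := HB.pack nu0
  (isCharge.Build _ (measurableTypeR R) R nu0 nu00 nufin
    (dyadic_limit_sigma_additive T f U T0 acf UU Uoo)).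
have numu : nu `<< mu.
  apply/null_content_dominatesP => A mA A0.
  by rewrite /nu/= /nu0/= dyadic_limit_null.
pose g : R -> R := fun t => fine (Radon_Nikodym nu mu t).
have gE : EFin \o g = Radon_Nikodym nu mu.
  by apply/funext => t; rewrite /= fineK// Radon_Nikodym_fin_num.
have ig : mu.-integrable setT (EFin \o g) by rewrite gE; exact: Radon_Nikodym_integrable.
have fE x : 0 <= x -> x < T -> f x - f 0 = \int[mu]_(t in `]0, x]) g t.
  move=> x0 xT; rewrite /Rintegral.
  have := Radon_Nikodym_integral numu (measurable_itv `]0, x]).
  rewrite -gE => <-; rewrite /nu/= /nu0/= dyadic_limit_itv//.
exists g; split => //.
have iyg y : mu.-integrable [set` Interval (BRight 0) (BRight y)] (EFin \o g).
  exact: integrableS ig.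
have lg : locally_integrable [set: R] g by apply: open_integrable_locally => //; exact: openT.
pose F y := \int[mu]_(t in `]0, y]) g t.
have := FTC1 iyg lg; apply: filterS; first exact: (ae_filter_ringOfSetsType mu).
move=> x /= H /andP[x0 xT].
have [dF <-] := H x0.
move/derivable_cvg: dF; rewrite -/F; apply: cvg_trans; apply: near_eq_cvg.
(* For [h] this small, [h + x] stays in []0, T[], where [f] and [F] differ by the constant [f 0]. *)
have nx : 0 < Num.min x (T - x) by rewrite lt_min x0/= subr_gt0.
near=> h; congr (_ *: _).
have [hx hT] : - x < h /\ h < T - x.
  have : `|h| < Num.min x (T - x) by near: h; exact: dnbhs0_lt.
  by rewrite lt_min => /andP[]; rewrite ltr_norml ltr_norml => /andP[? _] /andP[_ ?].
rewrite -[LHS]/(F (h + x) - F x).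
have -> : F (h + x) = f (h + x) - f 0 by rewrite fE//; lra.
have -> : F x = f x - f 0 by rewrite fE//; lra.
ring.
Unshelve. all: by end_near. Qed.

End density.

(** * Measurability of the derivative of a continuous curve *)

Lemma continuous_pair {X Y Z : topologicalType} (f : X -> Y) (g : X -> Z) (x : X) :
  {for x, continuous f} -> {for x, continuous g} ->
  {for x, continuous (fun x => (f x, g x))}.
Proof. by move=> fx gx; apply: (@cvg_pair _ _ _ _ (nbhs (f x)) (nbhs (g x))). Qed.

Section derivative_measurable.
Context {R : realType} {n : nat}.
Variable f : R -> 'rV[R]_n.
Hypothesis cf : continuous f.

Let q (h s : R) : 'rV[R]_n := h^-1 *: (f (h + s) - f s).

Let cq h : continuous (q h).
Proof.
move=> s; apply: cvgZr; apply: cvgB; last exact: cf.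
apply: continuous_comp; last exact: cf.
by apply: cvgD; [exact: cvg_cst|exact: cvg_id].
Qed.

Let C (k m : nat) := [set s | forall h h' : R, h != 0 -> h' != 0 ->
  `|h| < m.+1%:R^-1 -> `|h'| < m.+1%:R^-1 -> `|q h s - q h' s| <= k.+1%:R^-1].

Let closedC k m : closed (C k m).
Proof.
have -> : C k m = \bigcap_(z in [set z : R * R | [/\ z.1 != 0, z.2 != 0,
    `|z.1| < m.+1%:R^-1 & `|z.2| < m.+1%:R^-1]])
    [set s | `|q z.1 s - q z.2 s| <= k.+1%:R^-1].
  apply/seteqP; split => [s H [h h'] []|s H h h' h0 h'0 hm h'm]; first exact: H.
  exact: (H (h, h')).
apply: closed_bigI => -[h h'] _ /=.
apply: (@closed_comp _ _ (fun s => `|q h s - q h' s|) [set x | x <= k.+1%:R^-1]).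
  by move=> s _; apply: cvg_norm; apply: cvgB; exact: cq.
exact: closed_le.
Qed.

Definition derivable_set : set R := [set s | cvg (q h s @[h --> 0^'])].

(** The Cauchy criterion for the difference quotients. Each [C k m] is closed because [f] is
    continuous, so the set of differentiability is a countable intersection of countable unions of
    closed sets. *)
Lemma derivable_setE : derivable_set = \bigcap_k \bigcup_m C k m.
Proof.
apply/seteqP; split => s.
  move=> /cvg_ex[l /cvgrPdist_lt ql] k _.
  have k0 : 0 < k.+1%:R^-1 / 2 :> R by rewrite divr_gt0// invr_gt0.
  have [d /= d0 H] := ql _ k0.
  have [m _ md] := @near_infty_natSinv_lt R (PosNum d0).
  exists m => // h h' h0 h'0 hm h'm.
  have -> : q h s - q h' s = (l - q h' s) - (l - q h s) by rewrite opprB [RHS]addrC addrA subrK.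
  rewrite (le_trans (ler_normB _ _))// [leRHS]splitr; have := md m (leqnn _).
  by move=> {}md; apply: lerD; apply/ltW/H => //=; rewrite sub0r normrN (lt_trans _ md).
move=> H; apply: cauchy_cvg; apply: cauchy_exP => e e0.
have [k _ ke] := @near_infty_natSinv_lt R (PosNum e0).
have {}ke := ke k (leqnn _).
have [m _ Hm] := H k I.
have m0 : 0 < m.+1%:R^-1 :> R by rewrite invr_gt0.
exists (q (m.+1%:R^-1 / 2) s).
exists m.+1%:R^-1 => //= h /=; rewrite sub0r normrN => hm h0.
rewrite -ball_normE /=; apply: le_lt_trans ke; apply: Hm => //.
by rewrite gtr0_norm ?divr_gt0// ltr_pdivrMr// ltr_pMr// ltr1n.
Qed.

Lemma measurable_derivable_set : measurable derivable_set.
Proof.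
rewrite derivable_setE; apply: bigcap_measurable => [|k _]; first by exists 0%N.
apply: bigcup_measurable => m _; exact: closed_measurable.
Qed.

(** Where [f] is differentiable, the function is a pointwise limit of continuous ones, obtained from
    the quotients with step [m.+1%:R^-1]. *)
Lemma measurable_fun_derive1 (Psi : R -> 'rV[R]_n -> R) :
  continuous (fun z : R * 'rV[R]_n => Psi z.1 z.2) ->
  measurable_fun setT (fun s => Psi s (derive1 f s)).
Proof.
move=> cPsi.
have cPc (u : R -> 'rV[R]_n) : continuous u -> measurable_fun setT (fun s => Psi s (u s)).
  move=> cu; apply: continuous_measurable_fun => s.
  apply: (@continuous_comp _ _ _ (fun s => (s, u s)) (fun z => Psi z.1 z.2)); last exact: cPsi.
  by apply: continuous_pair; [exact: cvg_id|exact: cu].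
rewrite -(setUv derivable_set); apply/measurable_funU.
- exact: measurable_derivable_set.
- by apply: measurableC; exact: measurable_derivable_set.
split.
- apply: (@measurable_fun_cvg _ _ _ _ (fun m s => Psi s (q m.+1%:R^-1 s))).
    by move=> m; apply: measurable_funTS; apply: cPc; exact: cq.
  move=> s Ds /=.
  have cPs : {for derive1 f s, continuous (Psi s)}.
    apply: (@continuous_comp _ _ _ (fun v => (s, v)) (fun z => Psi z.1 z.2)); last exact: cPsi.
    by apply: continuous_pair; [exact: (@cst_continuous _ _ s)|exact: cvg_id].
  have qd : q h s @[h --> 0^'] --> derive1 f s by exact: Ds.
  apply: (@cvg_comp _ _ _ (fun m => q m.+1%:R^-1 s) (Psi s) _ _ _ _ cPs).
  apply: (@cvg_comp _ _ _ (fun m => m.+1%:R^-1) (fun h => q h s) _ _ _ _ qd).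
  move=> A [e /= e0 He].
  have [m _ me] := @near_infty_natSinv_lt R (PosNum e0).
  exists m => // i /= mi; apply: He => //=.
  by rewrite sub0r normrN gtr0_norm ?invr_gt0//; exact: me.
(* Where the quotients diverge, [derive1] takes the default value [point], a constant. *)
- apply: (@eq_measurable_fun _ _ _ _ _ (fun s => Psi s point)).
    move=> s; rewrite inE => Ds; congr Psi.
    by apply/esym; apply: dvgP; exact: Ds.
  by apply: measurable_funTS; apply: cPc => s; exact: cvg_cst.
Qed.

End derivative_measurable.

(** * The running cost of an absolutely continuous curve *)

Lemma cvg_rsum {R : realType} {S : Type} (F : set_system S) (I : finType)
    (u : I -> S -> R) (l : I -> R) : Filter F ->
  (forall i, u i @ F --> l i) -> \sum_i u i s @[s --> F] --> \sum_i l i.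
Proof. by move=> FF ul; apply: cvg_big => //; exact: add_continuous. Qed.

Section euclidean.
Context {R : realType} {n : nat}.
Implicit Types (p u v : 'rV[R]_n) (eta : R -> 'rV[R]_n).

Lemma dot_ge0 v : 0 <= dot v v.
Proof. by apply: sumr_ge0 => i _; rewrite -expr2 sqr_ge0. Qed.

Lemma enorm_ge0 v : 0 <= enorm v.
Proof. exact: sqrtr_ge0. Qed.

Lemma enorm_sqr v : enorm v ^+ 2 = dot v v.
Proof. by rewrite sqr_sqrtr// dot_ge0. Qed.

Lemma coord_le_enorm v i : `|v 0 i| <= enorm v.
Proof.
rewrite -(@ler_pXn2r _ 2)// ?nnegrE ?enorm_ge0// enorm_sqr real_normK ?num_real//.
rewrite /dot (bigD1 i)//= -expr2 lerDl.
by apply: sumr_ge0 => j _; rewrite -expr2 sqr_ge0.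
Qed.

Lemma norm_le_enorm v : `|v| <= enorm v.
Proof.
rewrite -[leLHS]/(mx_norm v).
have [->|/mx_norm_neq0[i ->]] := eqVneq (mx_norm v) 0; first exact: enorm_ge0.
by rewrite ord1 coord_le_enorm.
Qed.

Lemma dotZl (k : R) u v : dot (k *: u) v = k * dot u v.
Proof. by rewrite /dot mulr_sumr; apply: eq_bigr => i _; rewrite mxE mulrA. Qed.

Lemma dotZr (k : R) u v : dot u (k *: v) = k * dot u v.
Proof. by rewrite /dot mulr_sumr; apply: eq_bigr => i _; rewrite mxE mulrCA. Qed.

Lemma dotNr u v : dot u (- v) = - dot u v.
Proof. by rewrite -scaleN1r dotZr mulN1r. Qed.

Lemma dotBr u v p : dot p (u - v) = dot p u - dot p v.
Proof.
by rewrite /dot -sumrB; apply: eq_bigr => i _; rewrite !mxE mulrBr.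
Qed.

(** Young's inequality, by completing a square in each coordinate. *)
Lemma dot_le (k : R) p v : 0 < k -> dot p v <= k^-1 * enorm v ^+ 2 + k * enorm p ^+ 2 / 4.
Proof.
move=> k0; rewrite !enorm_sqr /dot mulr_sumr mulr_sumr mulr_suml -big_split/=.
apply: ler_sum => i _; rewrite -subr_ge0.
rewrite (_ : _ - _ = k^-1 * (v 0 i - k * p 0 i / 2) ^+ 2).
  by rewrite mulr_ge0 ?sqr_ge0// invr_ge0 ltW.
by field; rewrite gt_eqF.
Qed.

Lemma rV_cvg {S : Type} (F : set_system S) (u : S -> 'rV[R]_n) v : Filter F ->
  (forall i, u s 0 i @[s --> F] --> v 0 i) -> u @ F --> v.
Proof.
move=> FF H; apply/cvg_ballP => e e0.
have : \forall s \near F, forall i, ball (v 0 i) e (u s 0 i).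
  by apply: filter_forall => i; have /cvg_ballP/(_ e e0) := H i.
by apply: filterS => s Hs; split=> // i j; rewrite ord1; exact: Hs.
Qed.

Lemma dot_continuous p : continuous (dot p).
Proof.
move=> v; apply: (@cvg_rsum R _ (nbhs v) _ _ _ (nbhs_filter v)) => i.
apply: cvgMr.
exact: coord_continuous.
Qed.

Lemma enorm_continuous : continuous (@enorm R n).
Proof.
move=> v; apply: continuous_comp; last exact: sqrt_continuous.
apply: (@cvg_rsum R _ (nbhs v) _ _ _ (nbhs_filter v)) => i.
by apply: cvgM; exact: coord_continuous.
Qed.

Lemma abs_continuous_coord eta T i : 0 < T -> abs_continuous eta ->
  real_abs_continuous_on 0 T (fun s => eta s 0 i).
Proof.
move=> T0 /(_ T T0) ace e /ace[d d0 H]; exists d => // m l r lr tlr lrd.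
apply: le_lt_trans (H m l r lr tlr lrd); apply: ler_sum => j _.
by apply: le_trans (coord_le_enorm _ i); rewrite !mxE.
Qed.

(** Values at negative times are arbitrary; freezing the curve at its initial point there gives a
    function continuous on the whole line. *)
Lemma abs_continuous_continuous eta : abs_continuous eta ->
  continuous (fun s : R => eta (Num.max s 0)).
Proof.
move=> ace s; apply: rV_cvg => i; apply/cvgrPdist_lt => e e0.
(* This horizon contains the truncations of all times within distance 1 of [s]. *)
have T0 : 0 < Num.max s 0 + 1 by rewrite ltr_wpDl// le_max lexx orbT.
have [d d0 H] := ac_uniform_continuous _ _ _ (abs_continuous_coord eta _ i T0 ace) e e0.
near=> t.
have td : `|s - t| < d by near: t; apply: cvgr_dist_lt => //; exact: cvg_id.
have t1 : `|s - t| < 1 by near: t; apply: cvgr_dist_lt => //; exact: cvg_id.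
move: td t1; rewrite 2!ltr_norml => /andP[t1 t2] /andP[t3 t4].
have [st|ts] := leP (Num.max s 0) (Num.max t 0).
  rewrite distrC; apply: H => //; first by rewrite le_max lexx orbT.
    by move: st; rewrite /Order.max; case: ifPn; case: ifPn; rewrite -?leNgt; lra.
  by move: st; rewrite /Order.max; case: ifPn; case: ifPn; rewrite -?leNgt; lra.
apply: H => //; first by rewrite le_max lexx orbT.
- exact: ltW.
- by rewrite lerDl.
- by move: ts; rewrite /Order.max; case: ifPn; case: ifPn; rewrite -?leNgt; lra.
Unshelve. all: by end_near. Qed.

End euclidean.

Section curve.
Context {R : realType} {n : nat}.
Local Notation mu := (@lebesgue_measure R).
Implicit Types (p v : 'rV[R]_n) (eta : R -> 'rV[R]_n).

Lemma derive1_pos_part eta s : 0 < s ->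
  derive1 (fun s : R => eta (Num.max s 0)) s = derive1 eta s.
Proof.
move=> s0; rewrite !derive1E; apply: near_eq_derive.
by near=> t; rewrite (max_idPl _)// ltW//; near: t; exact: lt_nbhsr s0.
Unshelve. all: by end_near. Qed.

Lemma measurable_fun_derive1_gt0 eta (Psi : R -> 'rV[R]_n -> 'rV[R]_n -> R) :
  abs_continuous eta ->
  continuous (fun z : R * 'rV[R]_n * 'rV[R]_n => Psi z.1.1 z.1.2 z.2) ->
  measurable_fun (`]0%R, +oo[ : set R) (fun s => Psi s (eta s) (derive1 eta s)).
Proof.
move=> ace cPsi; have ce := abs_continuous_continuous eta ace.
apply: (@eq_measurable_fun _ _ _ _ _
   (fun s => Psi s (eta (Num.max s 0)) (derive1 (fun s : R => eta (Num.max s 0)) s))).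
  move=> s; rewrite inE/= in_itv/= andbT => s0.
  by rewrite (max_idPl (ltW s0)) derive1_pos_part.
apply: measurable_funTS.
apply: (measurable_fun_derive1 _ ce (fun s v => Psi s (eta (Num.max s 0)) v)) => -[s v].
apply: (@continuous_comp _ _ _
  (fun z : R * 'rV[R]_n => ((z.1, eta (Num.max z.1 0)), z.2))
  (fun z => Psi z.1.1 z.1.2 z.2)); last exact: cPsi.
have c1 : {for (s, v), continuous (fst : R * 'rV[R]_n -> R)}.
  by apply: (@cvg_fst _ _ (nbhs s) (nbhs v)).
apply: continuous_pair; last by apply: (@cvg_snd _ _ (nbhs s) (nbhs v)).
apply: continuous_pair => //.
by apply: (@continuous_comp _ _ _ fst (fun s : R => eta (Num.max s 0)) _ c1); exact: ce.
Qed.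

Lemma abs_continuous_vector_density eta T : abs_continuous eta -> 0 < T ->
  exists g : 'I_n -> R -> R,
  [/\ forall i, mu.-integrable setT (EFin \o g i),
      forall i x, 0 <= x -> x < T -> eta x 0 i - eta 0 0 i = \int[mu]_(t in `]0, x]) g i t
    & {ae mu, forall x, 0 < x < T ->
        h^-1 *: (eta (h + x) - eta x) @[h --> 0^'] --> derive1 eta x /\
        forall i, derive1 eta x 0 i = g i x}].
Proof.
move=> ace T0.
have H i := abs_continuous_density T _ T0 (abs_continuous_coord eta T i T0 ace).
have [g Hg] := choice H.
exists g; split.
- by move=> i; have [] := Hg i.
- by move=> i; have [] := Hg i.
have : {ae mu, forall x, forall i, 0 < x < T ->
    h^-1 *: (eta (h + x) 0 i - eta x 0 i) @[h --> 0^'] --> g i x}.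
  have FF := ae_filter_ringOfSetsType mu.
  by apply: (@filter_forall _ _ _ _ FF) => i; have [] := Hg i.
apply: filterS; first exact: (ae_filter_ringOfSetsType mu).
move=> x /= Hx xT.
have cx : h^-1 *: (eta (h + x) - eta x) @[h --> 0^'] --> \row_i g i x.
  apply: rV_cvg => i; rewrite mxE; apply: cvg_trans (Hx i xT).
  by apply: near_eq_cvg; near=> h; rewrite !mxE.
have dE : derive1 eta x = \row_i g i x by apply: cvg_lim cx.
by split => [|i]; rewrite dE// mxE.
Unshelve. all: by end_near. Qed.
End curve.

Lemma le_integral_funepos {d} {X : measurableType d} {R : realType}
    (mu : {measure set X -> \bar R}) (D : set X) (f : X -> \bar R) :
  (\int[mu]_(x in D) f x <= \int[mu]_(x in D) (f^\+ x))%E.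
Proof.
rewrite integralE -[leRHS]sube0 leeB//.
by apply: integral_ge0 => x _; exact: funeneg_ge0.
Qed.

Lemma itv_oc_measure {R : realType} (a b : R) : a <= b ->
  lebesgue_measure (`]a, b]%classic : set R) = (b - a)%:E.
Proof.
move=> ab; rewrite lebesgue_measure_itv/= lte_fin.
by case: ltgtP ab => // -> _; rewrite subrr.
Qed.

Section running_cost.
Context {R : realType} {n : nat}.
Local Notation mu := (@lebesgue_measure R).
Variables (L : 'rV[R]_n -> 'rV[R]_n -> R) (B : R).
Hypothesis cL : continuous (fun z : 'rV[R]_n * 'rV[R]_n => L z.1 z.2).
Hypothesis LB : forall x v, 0 <= L x v + B.
Implicit Types (p v : 'rV[R]_n) (eta : R -> 'rV[R]_n).

(** The shift by [B] makes the integrand nonnegative. Since [expR (- s)] has integral 1 on the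
    half-line, it adds exactly [B] to the action. *)
Definition running_cost eta (s : R) : R :=
  expR (- s) * (L (eta s) (- derive1 eta s) + B).

Lemma running_cost_ge0 eta s : 0 <= running_cost eta s.
Proof. by rewrite mulr_ge0 ?expR_ge0. Qed.

Lemma measurable_running_cost eta : abs_continuous eta ->
  measurable_fun (`]0%R, +oo[ : set R) (EFin \o running_cost eta).
Proof.
move=> ace; apply/measurable_EFinP.
apply: (measurable_fun_derive1_gt0 _ (fun s x v => expR (- s) * (L x (- v) + B)) ace).
move=> [[s x] v]; apply: cvgM.
  apply: (@continuous_comp _ _ _ (fun z : R * 'rV[R]_n * 'rV[R]_n => - z.1.1) expR).
    apply: cvgN; apply: (@continuous_comp _ _ _ fst fst).
      by apply: (@cvg_fst _ _ (nbhs (s, x)) (nbhs v)).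
    by apply: (@cvg_fst _ _ (nbhs s) (nbhs x)).
  exact: continuous_expR.
apply: cvgD; last exact: cvg_cst.
apply: (@continuous_comp _ _ _ (fun z : R * 'rV[R]_n * 'rV[R]_n => (z.1.2, - z.2))
  (fun z => L z.1 z.2)); last exact: cL.
apply: continuous_pair.
  apply: (@continuous_comp _ _ _ fst snd).
    by apply: (@cvg_fst _ _ (nbhs (s, x)) (nbhs v)).
  by apply: (@cvg_snd _ _ (nbhs s) (nbhs x)).
by apply: cvgN; apply: (@cvg_snd _ _ (nbhs (s, x)) (nbhs v)).
Qed.

(* The hypothesis holds with c the supremum of H(x, p) - B along the curve, by
   Fenchel's inequality, and with c = A |p|^2 / 4 by quadratic growth. *)
Lemma running_cost_lower eta a b c p : abs_continuous eta -> 0 <= a -> a < b ->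
  (forall s v, a < s -> s <= b -> dot p v <= L (eta s) v + B + c) ->
  ((- dot p (eta b - eta a) - c * (b - a))%:E <=
   (expR b)%:E * \int[mu]_(s in `]a, b]) (running_cost eta s)%:E)%E.
Proof.
move=> ace a0 ab pL.
(* The density formula holds strictly before the horizon, so the horizon is taken beyond [b]. *)
have T0 : 0 < b + 1 by lra.
have [g [ig gE aeg]] := abs_continuous_vector_density eta (b + 1) ace T0.
have ie i : mu.-integrable `]a, b] (EFin \o g i) by exact: integrableS (ig i).
have DE i : (\int[mu]_(s in `]a, b]) (g i s)%:E = (eta b 0 i - eta a 0 i)%:E)%E.
  have := @Rintegral_itvB R (g i) (BRight 0) (BRight b) a.
  rewrite -(gE i b) -?(gE i a) ?bnd_simp; [|lra..].
  move=> H; rewrite -[LHS]fineK; last by apply: integrable_fin_num => //; exact: (ie i).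
  rewrite -[fine _]/(Rintegral _ _ _) -H//; last by rewrite ltW.
    by congr EFin; ring.
  exact: (integrableS _ _ _ (ig i)).
have ic : mu.-integrable `]a, b] (EFin \o cst c : R -> \bar R).
  apply/integrableP; split; first exact/measurable_EFinP.
  under eq_integral do rewrite /=.
  by rewrite integral_cst//= itv_oc_measure ?(ltW ab)// -EFinM ltry.
pose G s := \sum_i - p 0 i * g i s.
have iG : mu.-integrable `]a, b] (EFin \o G).
  rewrite [X in _.-integrable _ X](_ : _ = fun s => (\sum_i (- p 0 i)%:E * (g i s)%:E)%E).
    by apply: integrable_sum => // i _; apply: integrableZl => //; exact: (ie i).
  by apply/funext => s; rewrite /= /G -sumEFin.
have iGc : mu.-integrable `]a, b] (fun s => (G s)%:E - c%:E)%E by apply: integrableB.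
have <- : (\int[mu]_(s in `]a, b]) ((G s)%:E - c%:E) =
    (- dot p (eta b - eta a) - c * (b - a))%:E)%E.
  rewrite (integralB_EFin _ iG ic)// EFinB; congr (_ - _)%E; last first.
    rewrite -[LHS]/(\int[mu]_(s in `]a, b]) cst c%:E s)%E integral_cst//=.
    by rewrite itv_oc_measure ?(ltW ab).
  under eq_integral do rewrite /G -sumEFin.
  rewrite integral_sum//; last by move=> i; exact: (integrableZl _ (- p 0 i) (ie i)).
  rewrite /dot -sumrN -sumEFin; apply: eq_bigr => i _.
  under eq_integral do rewrite EFinM.
  by rewrite (integralZl _ (ie i))// DE -EFinM !mxE mulNr.
(* The pointwise comparison holds only almost everywhere and is integrated between nonnegative
   functions, hence the passage to the positive part. *)
apply: le_trans (le_integral_funepos _ _ _) _.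
have mw : measurable_fun `]a, b] (EFin \o running_cost eta).
  apply: measurable_funS (measurable_running_cost eta ace) => //.
  by move=> s; rewrite /= !in_itv/= andbT => /andP[/(le_lt_trans a0)].
rewrite -ge0_integralZl//; last by move=> s _; rewrite lee_fin running_cost_ge0.
apply: ae_ge0_le_integral => //.
- by apply: measurable_funepos; exact: measurable_int iGc.
- by move=> s _; rewrite mule_ge0// lee_fin ?expR_ge0 ?running_cost_ge0.
- exact: measurable_funeM.
apply: filterS aeg; first exact: (ae_filter_ringOfSetsType mu).
move=> s /= H; rewrite in_itv/= => /andP[as_ sb].
have [|_ Hd] := H; first by lra.
rewrite funeposE -EFinB -EFinM -EFin_max lee_fin ge_max.
have L0 := LB (eta s) (- derive1 eta s).
apply/andP; split; last by rewrite mulr_ge0 ?expR_ge0 ?running_cost_ge0.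
have -> : G s = dot p (- derive1 eta s).
  by rewrite /dot; apply: eq_bigr => i _; rewrite !mxE Hd mulrN mulNr.
rewrite lerBlDr; apply: le_trans (pL s _ as_ sb) _.
rewrite lerD2r /running_cost mulrA -expRD ler_peMl// -expR0 ler_expR.
by rewrite subr_ge0.
Qed.

End running_cost.

(** The integral of [f] may be infinite. Since [f >= - g], its negative part is at most [g] and has
    finite integral, so it can be moved to the other side. *)
Lemma integralD_lower_bounded {d} {X : measurableType d} {R : realType}
    (mu : {measure set X -> \bar R}) (D : set X) (f g : X -> R) : measurable D ->
  measurable_fun D f -> measurable_fun D g -> (forall x, D x -> 0 <= g x) ->
  (forall x, D x -> 0 <= f x + g x) -> (\int[mu]_(x in D) (g x)%:E < +oo)%E ->
  (\int[mu]_(x in D) (f x)%:E + \int[mu]_(x in D) (g x)%:E =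
   \int[mu]_(x in D) (f x + g x)%:E)%E.
Proof.
move=> mD mf mg g0 fg0 goo.
have mEf : measurable_fun D (EFin \o f) by exact/measurable_EFinP.
have mEg : measurable_fun D (EFin \o g) by exact/measurable_EFinP.
have mfg : measurable_fun D (fun x => (f x + g x)%:E).
  by apply/measurable_EFinP; exact: measurable_funD.
rewrite integralE.
have n0 : (0 <= \int[mu]_(x in D) ((EFin \o f)^\- x))%E.
  by apply: integral_ge0 => x _; exact: funeneg_ge0.
have nfin : (\int[mu]_(x in D) ((EFin \o f)^\- x))%E \is a fin_num.
  rewrite ge0_fin_numE//; apply: le_lt_trans goo; apply: ge0_le_integral => //.
  - exact: measurable_funeneg.
  - move=> x Dx; rewrite funenegE -EFin_max lee_fin ge_max g0// andbT.
    by have := fg0 x Dx; lra.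
(* What remains is the integral of the identity [f^\+ + g = (f + g) + f^\-], whose terms are all
   nonnegative. *)
rewrite addeAC -[RHS](addeK _ nfin); congr (_ - _)%E.
rewrite -!ge0_integralD//.
- apply: eq_integral => x _.
  rewrite funeposE funenegE /= -!EFin_max -!EFinD; congr EFin.
  by rewrite /Order.max; case: ifPn; case: ifPn; rewrite -?leNgt; lra.
- exact: measurable_funeneg.
- exact: measurable_funepos.
Qed.

(** * The action, the value and minimizing sequences *)

Section action.
Context {R : realType}.
Local Notation mu := (@lebesgue_measure R).

Lemma integral_expRN : (\int[mu]_(s in `]0%R, +oo[) (expR (- s))%:E = 1)%E.
Proof.
have c : continuous (fun s : R => expR (- s)).
  by move=> s; apply: continuous_comp; [exact: cvgN|exact: continuous_expR].
rewrite integral_itv_obnd_cbnd; last first.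
  by apply/measurable_EFinP; apply: measurable_funTS; exact: continuous_measurable_fun.
rewrite (@ge0_continuous_FTC2y _ _ (fun s => - expR (- s)) _ 0).
- by rewrite oppr0 expR0 EFinN oppeK add0e.
- by move=> x _; exact: expR_ge0.
- exact: continuous_subspaceT.
- rewrite -oppr0; apply: cvgN; exact: cvgr_expR.
- by move=> x _; exact: ex_derive.
- by apply: cvgN; apply: cvg_at_right_filter; exact: c.
- move=> x _; rewrite derive1E derive_val.
  by rewrite mulrN1 opprK.
Qed.

Context {n : nat}.
Variables (L : 'rV[R]_n -> 'rV[R]_n -> R) (A B : R).
Hypothesis cL : continuous (fun z : 'rV[R]_n * 'rV[R]_n => L z.1 z.2).
Hypothesis A0 : 0 < A.
Hypothesis B0 : 0 < B.
Hypothesis growth : forall x v, A^-1 * enorm v ^+ 2 - B <= L x v <= A * enorm v ^+ 2 + B.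
Implicit Types (x p v : 'rV[R]_n) (eta : R -> 'rV[R]_n).

Lemma lagrangian_ge0 x v : 0 <= L x v + B.
Proof.
have /andP[+ _] := growth x v; rewrite lerBlDr; apply: le_trans.
by rewrite mulr_ge0 ?sqr_ge0// invr_ge0 ltW.
Qed.

Lemma measurable_expRNM (D : set R) (k : R) :
  measurable_fun D (fun s => expR (- s) * k).
Proof.
apply: measurable_funTS; apply: continuous_measurable_fun => s.
apply: cvgM; last exact: cvg_cst.
by apply: continuous_comp; [exact: cvgN|exact: continuous_expR].
Qed.

Lemma integral_expRNM (k : R) : 0 <= k ->
  (\int[mu]_(s in `]0%R, +oo[) (expR (- s) * k)%:E = k%:E)%E.
Proof.
move=> k0.
under eq_integral do rewrite mulrC EFinM.
rewrite ge0_integralZl ?lee_fin//; first by rewrite integral_expRN mule1.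
- have := measurable_expRNM `]0%R, +oo[ 1.
  by move/measurable_EFinP; apply: eq_measurable_fun => s _ /=; rewrite mulr1.
Qed.

Lemma action_running_cost eta : abs_continuous eta ->
  (action L eta + B%:E = \int[mu]_(s in `]0%R, +oo[) (running_cost L B eta s)%:E)%E.
Proof.
move=> ace; rewrite -[in LHS](integral_expRNM B (ltW B0)) /action integralD_lower_bounded//.
- by apply: eq_integral => s _; rewrite /running_cost mulrDr.
- have /measurable_EFinP := measurable_running_cost L 0 cL eta ace.
  by apply: eq_measurable_fun => s _; rewrite /running_cost addr0.
- exact: measurable_expRNM.
- by move=> s _; rewrite mulr_ge0 ?expR_ge0// ltW.
- by move=> s _; rewrite -mulrDr mulr_ge0 ?expR_ge0// lagrangian_ge0.
- by rewrite integral_expRNM ?ltry// ltW.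
Qed.

Lemma action_ge eta : abs_continuous eta -> ((- B)%:E <= action L eta)%E.
Proof.
move=> ace; rewrite EFinN -[leLHS]add0e leeBlDr// action_running_cost//.
by apply: integral_ge0 => s _; rewrite lee_fin running_cost_ge0//; exact: lagrangian_ge0.
Qed.

Lemma admissible_cst x : admissible x (cst x).
Proof.
split=> // T T0 e e0; exists 1 => // m l r _ _ _.
rewrite big1// => i _; rewrite subrr /enorm /dot big1 ?sqrtr0// => j _.
by rewrite mxE mul0r.
Qed.

Lemma action_cst_le x : (action L (cst x) <= B%:E)%E.
Proof.
have [ace _] := admissible_cst x.
rewrite -(leeD2rE (x := B%:E))// action_running_cost// -EFinD.
rewrite -(integral_expRNM (B + B)); last by rewrite addr_ge0// ltW.
apply: ge0_le_integral => //.
- by move=> s _; rewrite lee_fin running_cost_ge0//; exact: lagrangian_ge0.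
- exact: measurable_running_cost.
- by apply/measurable_EFinP; exact: measurable_expRNM.
move=> s _; rewrite lee_fin /running_cost ler_wpM2l ?expR_ge0// lerD2r.
have /andP[_] := growth x 0.
rewrite (_ : enorm 0 = 0) ?expr0n ?mulr0 ?add0r; last first.
  by rewrite /enorm /dot big1 ?sqrtr0// => j _; rewrite mxE mul0r.
by rewrite derive1_cst oppr0.
Qed.

(** The infimum lies between [- B], a bound for every action, and [B], a bound for the constant
    curve; [fine] therefore loses nothing. *)
Lemma valueE x : (value L x)%:E = ereal_inf [set action L eta | eta in admissible x].
Proof.
rewrite /value fineK// fin_numElt; apply/andP; split.
  apply: (@lt_le_trans _ _ (- B)%:E); first exact: ltNyr.
  by apply: le_ereal_inf_tmp => _ [eta [ace _] <-]; exact: action_ge.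
apply: (@le_lt_trans _ _ B%:E); last exact: ltry.
apply: le_trans (action_cst_le x); apply: ereal_inf_lbound.
by exists (cst x) => //; exact: admissible_cst.
Qed.

Lemma value_le x : value L x <= B.
Proof.
rewrite -lee_fin valueE; apply: le_trans (action_cst_le x).
by apply: ereal_inf_lbound; exists (cst x) => //; exact: admissible_cst.
Qed.

Lemma value_le_action x eta : admissible x eta -> ((value L x)%:E <= action L eta)%E.
Proof. by move=> ax; rewrite valueE; apply: ereal_inf_lbound; exists eta. Qed.

Lemma minimizing_sequence x : exists eta : nat -> R -> 'rV[R]_n, forall k,
  admissible x (eta k) /\
  (\int[mu]_(s in `]0%R, +oo[) (running_cost L B (eta k) s)%:E <=
   (value L x + B + k.+1%:R^-1)%:E)%E.
Proof.
suff H k : exists eta, admissible x eta /\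
  (\int[mu]_(s in `]0%R, +oo[) (running_cost L B eta s)%:E <=
   (value L x + B + k.+1%:R^-1)%:E)%E by have [e He] := choice H; exists e.
have k0 : 0 < k.+1%:R^-1 :> R by rewrite invr_gt0.
have /ereal_inf_lt[_ [eta aeta <-] /ltW H] :
    (ereal_inf [set action L eta | eta in admissible x] < (value L x + k.+1%:R^-1)%:E)%E.
  by rewrite -valueE lte_fin ltrDl.
exists eta; split=> //; have [ace _] := aeta.
have -> : value L x + B + k.+1%:R^-1 = value L x + k.+1%:R^-1 + B by ring.
by rewrite -action_running_cost// [leRHS]EFinD leeD2rE.
Qed.

End action.

(** * The ultrafilter limit of a minimizing sequence *)

Lemma enorm_distrC {R : realType} {n : nat} (u v : 'rV[R]_n) : enorm (u - v) = enorm (v - u).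
Proof.
rewrite -opprB /enorm /dot; congr Num.sqrt; apply: eq_bigr => i _.
by rewrite !mxE mulrNN.
Qed.

Lemma enorm_le_of_dot {R : realType} {n : nat} (E D : R) (u : 'rV[R]_n) : 0 <= D ->
  (forall p, - dot p u <= E + D * enorm p ^+ 2) ->
  forall l, l * enorm u <= E + D * l ^+ 2.
Proof.
move=> D0 H l; have [u0|u0] := eqVneq (enorm u) 0.
  have := H 0; rewrite enorm_sqr /dot !big1 ?oppr0 ?mulr0 ?addr0 => [E0|i _|i _].
  - by rewrite u0 mulr0 addr_ge0// mulr_ge0// sqr_ge0.
  - by rewrite mxE mul0r.
  - by rewrite mxE mul0r.
(* The test vector points against [u] and has length [|l|]. *)
have := H (- (l / enorm u) *: u).
rewrite enorm_sqr dotZl dotZl dotZr -enorm_sqr mulNr opprK.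
rewrite (_ : l / enorm u * enorm u ^+ 2 = l * enorm u); last by field.
by rewrite (_ : - (l / enorm u) * - (l * enorm u) = l ^+ 2)//; field.
Qed.

Lemma sum_integral_le {d} {X : measurableType d} {R : realType}
    (mu : {measure set X -> \bar R}) (m : nat) (F : 'I_m -> set X) (D : set X)
    (f : X -> \bar R) : measurable D -> (forall i, measurable (F i)) ->
  trivIset setT F -> (forall i, F i `<=` D) -> measurable_fun D f ->
  (forall x, D x -> (0 <= f x)%E) ->
  (\sum_(i < m) \int[mu]_(x in F i) f x <= \int[mu]_(x in D) f x)%E.
Proof.
move=> mD mF tF FD mf f0.
have UD : \big[setU/set0]_(i < m) F i `<=` D.
  by apply: (big_ind (fun B => B `<=` D)) => [|B C BD CD|i _]; rewrite ?sub0set ?subUset.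
rewrite -ge0_integral_bigsetU//=.
- apply: ge0_subset_integral => //; exact: bigsetU_measurable.
- exact: index_enum_uniq.
- exact: sub_trivIset tF.
- exact: measurable_funS mf.
- by move=> x /UD/f0.
Qed.

(** If two half-open intervals share a point, the midpoint between it and the larger left end lies
    in both open intervals. *)
Lemma trivIset_itv_oc {R : realType} (m : nat) (l r : 'I_m -> R) :
  trivIset setT (fun i => `]l i, r i[%classic) ->
  trivIset setT (fun i => `]l i, r i]%classic).
Proof.
move=> tlr i j _ _ [y []]; rewrite /= !in_itv/= => /andP[liy yri] /andP[ljy yrj].
apply: tlr => //; exists ((Num.max (l i) (l j) + y) / 2).
have [H1 H2] : l i <= Num.max (l i) (l j) /\ l j <= Num.max (l i) (l j).
  by rewrite !le_max !lexx orbT.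
have H3 : Num.max (l i) (l j) < y by rewrite gt_max liy.
split; rewrite /= in_itv/=; lra.
Qed.

Section limit_curve.
Context {R : realType} {n : nat}.
Local Notation mu := (@lebesgue_measure R).
Variables (L : 'rV[R]_n -> 'rV[R]_n -> R) (A B : R).
Hypothesis cL : continuous (fun z : 'rV[R]_n * 'rV[R]_n => L z.1 z.2).
Hypothesis A0 : 0 < A.
Hypothesis growth : forall x v, A^-1 * enorm v ^+ 2 - B <= L x v <= A * enorm v ^+ 2 + B.
Variables (x : 'rV[R]_n) (eta : nat -> R -> 'rV[R]_n) (C : R) (U : set_system nat).
Hypothesis aeta : forall k, admissible x (eta k).
Hypothesis costeta : forall k,
  (\int[mu]_(s in `]0%R, +oo[) (running_cost L B (eta k) s)%:E <= (C + k.+1%:R^-1)%:E)%E.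
Hypothesis UU : UltraFilter U.
Hypothesis Uoo : \oo `<=` U.

Let ace k : abs_continuous (eta k). Proof. by have [] := aeta k. Qed.
Let LB y v : 0 <= L y v + B. Proof. exact: lagrangian_ge0 growth _ _. Qed.

Definition cost_on (k : nat) (a b : R) : R :=
  fine (\int[mu]_(s in `]a, b]) (running_cost L B (eta k) s)%:E)%E.

Definition limit_cost (a b : R) : R := lim (cost_on k a b @[k --> U]).

(** Admissibility says nothing about [eta k] at negative times; the truncation makes the limit exist
    for every [t]. *)
Definition limit_curve (t : R) : 'rV[R]_n :=
  \row_i lim (eta k (Num.max t 0) 0 i @[k --> U]).

Let sub_itv (a b : R) : 0 <= a -> (`]a, b]%classic : set R) `<=` `]0, +oo[%classic.
Proof. by move=> a0 s; rewrite /= !in_itv/= andbT => /andP[/(le_lt_trans a0)]. Qed.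

Let cost_le k a b : 0 <= a ->
  (\int[mu]_(s in `]a, b]) (running_cost L B (eta k) s)%:E <= (C + 1)%:E)%E.
Proof.
move=> a0; apply: (@le_trans _ _ (C + k.+1%:R^-1)%:E); last first.
  by rewrite lee_fin lerD2l invf_le1// ler1n.
apply: le_trans (costeta k); apply: ge0_subset_integral => //.
- exact: measurable_running_cost.
- by move=> s _; rewrite lee_fin running_cost_ge0.
- exact: sub_itv.
Qed.

Let cost_integral_ge0 k (a b : R) :
  (0 <= \int[mu]_(s in `]a, b]) (running_cost L B (eta k) s)%:E)%E.
Proof. by apply: integral_ge0 => s _; rewrite lee_fin running_cost_ge0. Qed.

Lemma cost_onE k a b : 0 <= a -> (cost_on k a b)%:E =
  (\int[mu]_(s in `]a, b]) (running_cost L B (eta k) s)%:E)%E.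
Proof.
move=> a0; rewrite fineK// ge0_fin_numE//.
exact: le_lt_trans (cost_le k a b a0) (ltry _).
Qed.

Lemma cost_on_ge0 k a b : 0 <= cost_on k a b.
Proof. exact: fine_ge0. Qed.

Lemma cost_on_le k a b : 0 <= a -> cost_on k a b <= C + 1.
Proof. by move=> a0; rewrite -lee_fin cost_onE// cost_le. Qed.

Lemma limit_cost_cvg a b : 0 <= a -> cost_on k a b @[k --> U] --> limit_cost a b.
Proof.
move=> a0; apply: (ultra_cvg_lim _ (C + 1)); apply: nearW => k.
by rewrite ger0_norm ?cost_on_ge0 ?cost_on_le.
Qed.

Lemma limit_cost_ge0 a b : 0 <= a -> 0 <= limit_cost a b.
Proof.
move=> a0; have h := limit_cost_cvg a b a0.
apply: limr_ge; first by apply/cvg_ex; eexists; exact: h.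
by apply: nearW => k; exact: cost_on_ge0.
Qed.

(** This plays the role of a limit measure of mass at most [C]. The bound [C + k.+1%:R^-1] holds for
    each [k], and the excess vanishes along [U], which refines [\oo]. *)
Lemma sum_limit_cost_le m (l r : 'I_m -> R) : (forall i, 0 <= l i) ->
  trivIset setT (fun i => `]l i, r i]%classic) ->
  \sum_(i < m) limit_cost (l i) (r i) <= C.
Proof.
move=> l0 tlr.
have h : \sum_(i < m) cost_on k (l i) (r i) @[k --> U] -->
    \sum_(i < m) limit_cost (l i) (r i).
  by apply: (@cvg_rsum R _ U) => i; exact: limit_cost_cvg.
have hC : C + k.+1%:R^-1 @[k --> U] --> C.
  rewrite -[X in _ --> X]addr0; apply: cvgD; first exact: cvg_cst.
  apply: (@cvg_trans _ (k.+1%:R^-1 @[k --> \oo])); last exact: cvg_harmonic.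
  by move=> P; exact: Uoo.
apply: (ler_cvg_to h hC); apply: nearW => k.
rewrite -lee_fin -sumEFin; under eq_bigr do rewrite cost_onE//.
apply: le_trans (costeta k); apply: sum_integral_le => //.
- by move=> i; exact: sub_itv.
- exact: measurable_running_cost.
- by move=> s _; rewrite lee_fin running_cost_ge0.
Qed.

Lemma cost_on_lower k a b c p : 0 <= a -> a < b ->
  (forall s v, a < s -> s <= b -> dot p v <= L (eta k s) v + B + c) ->
  - dot p (eta k b - eta k a) <= expR b * cost_on k a b + c * (b - a).
Proof.
move=> a0 ab /(running_cost_lower L B cL LB _ a b c p (ace k) a0 ab).
by rewrite -cost_onE// -EFinM lee_fin lerBlDr.
Qed.

Lemma quadratic_increment k a b p : 0 <= a -> a < b ->
  - dot p (eta k b - eta k a) <=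
  expR b * cost_on k a b + A * (b - a) / 4 * enorm p ^+ 2.
Proof.
move=> a0 ab; apply: (@le_trans _ _
    (expR b * cost_on k a b + A * enorm p ^+ 2 / 4 * (b - a))); last first.
  by rewrite lerD2l le_eqVlt; apply/orP; left; apply/eqP; ring.
apply: cost_on_lower => // s v _ _.
(* Young's inequality with weight [A] produces the term [A^-1 * enorm v ^+ 2] of the growth
   bound. *)
rewrite (le_trans (dot_le A p v A0))// lerD2r.
by have /andP[+ _] := growth (eta k s) v; rewrite lerBlDr.
Qed.

(** Equicontinuity: after division by [l], the cost term is small for large [l], and the other is
    then small for small [b - a], uniformly in [k]. *)
Lemma curve_increment k a b l : 0 <= a -> a <= b ->
  l * enorm (eta k b - eta k a) <= expR b * cost_on k a b + A * (b - a) / 4 * l ^+ 2.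
Proof.
move=> a0; rewrite le_eqVlt => /predU1P[<-|ab]; last first.
  apply: enorm_le_of_dot => [|p]; last exact: quadratic_increment.
  by rewrite divr_ge0// mulr_ge0 ?subr_ge0// ltW.
rewrite !subrr mulr0 !mul0r addr0 /enorm /dot big1 ?sqrtr0 ?mulr0.
  by rewrite mulr_ge0 ?expR_ge0 ?cost_on_ge0.
by move=> i _; rewrite mxE mul0r.
Qed.

Lemma limit_curve_cvg t : eta k (Num.max t 0) @[k --> U] --> limit_curve t.
Proof.
apply: rV_cvg => i; rewrite mxE.
pose s := Num.max t 0; have s0 : 0 <= s by rewrite le_max lexx orbT.
(* The bound is [curve_increment] on [[0, s]] with [l = 1], all curves starting at [x]. *)
apply: (ultra_cvg_lim _ (`|x 0 i| + (expR s * (C + 1) + A * s / 4))).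
apply: nearW => k; rewrite -/s.
have -> : eta k s 0 i = x 0 i + (eta k s - x) 0 i by rewrite !mxE [RHS]addrC subrK.
rewrite (le_trans (ler_normD _ _))// lerD2l (le_trans (coord_le_enorm _ _))//.
have [_ <-] := aeta k.
have := curve_increment k 0 s 1 (lexx _) s0; rewrite mul1r expr1n mulr1 subr0.
move=> /le_trans; apply; rewrite lerD2r ler_wpM2l ?expR_ge0//.
exact: cost_on_le.
Qed.

Lemma limit_curve_cvg_ge0 t : 0 <= t -> eta k t @[k --> U] --> limit_curve t.
Proof. by move=> t0; have := limit_curve_cvg t; rewrite (max_idPl t0). Qed.

Lemma limit_curve0 : limit_curve 0 = x.
Proof.
apply/esym; have := limit_curve_cvg_ge0 0 (lexx _).
under eq_cvg do rewrite (proj2 (aeta _)).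
by move=> /cvg_lim <-//; apply/esym; apply: cvg_lim => //; exact: cvg_cst.
Qed.

Lemma limit_dot_cvg a b p : 0 <= a -> a <= b ->
  - dot p (eta k b - eta k a) @[k --> U] --> - dot p (limit_curve b - limit_curve a).
Proof.
move=> a0 ab; apply: cvgN; apply: (@cvg_comp _ _ _ _ (dot p)); last exact: dot_continuous.
by apply: cvgB; apply: limit_curve_cvg_ge0 => //; exact: le_trans ab.
Qed.

Lemma limit_increment a b l : 0 <= a -> a <= b ->
  l * enorm (limit_curve b - limit_curve a) <=
  expR b * limit_cost a b + A * (b - a) / 4 * l ^+ 2.
Proof.
move=> a0 ab.
have h1 : l * enorm (eta k b - eta k a) @[k --> U] -->
    l * enorm (limit_curve b - limit_curve a).
  apply: cvgMr; apply: (@cvg_comp _ _ _ _ (@enorm R n)); last exact: enorm_continuous.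
  by apply: cvgB; apply: limit_curve_cvg_ge0 => //; exact: le_trans ab.
have h2 : expR b * cost_on k a b + A * (b - a) / 4 * l ^+ 2 @[k --> U] -->
    expR b * limit_cost a b + A * (b - a) / 4 * l ^+ 2.
  by apply: cvgD; [apply: cvgMr; exact: limit_cost_cvg|exact: cvg_cst].
by apply: (ler_cvg_to h1 h2); apply: nearW => k; exact: curve_increment.
Qed.

Let C_ge0 : 0 <= C.
Proof.
have := sum_limit_cost_le 0 (fun=> 0) (fun=> 0) (fun=> lexx _).
by rewrite big_ord0; apply => -[].
Qed.

(** Summing [limit_increment] over disjoint intervals bounds [l] times the variation by a cost term,
    at most [expR T * C], plus a term proportional to the total length. *)
Lemma admissible_limit_curve : admissible x limit_curve.
Proof.
split; last exact: limit_curve0.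
move=> T T0 e e0.
(* This makes [expR T * (C + 1)] equal to [l * e / 2]; the total length below makes the second term
   less than [l * e / 2]. *)
pose l := 2 * expR T * (C + 1) / e.
have l0 : 0 < l by rewrite divr_gt0// !mulr_gt0 ?expR_gt0//; have := C_ge0; lra.
exists (2 * e / (A * l)); first by rewrite divr_gt0// mulr_gt0.
move=> m p q pq tpq pqd.
have p0 i : 0 <= p i by have [] := pq i.
have le_pq i : p i <= q i by have [] := pq i.
rewrite -(ltr_pM2l l0) mulr_sumr.
apply: (@le_lt_trans _ _ (\sum_(i < m) (expR T * limit_cost (p i) (q i) +
    A / 4 * l ^+ 2 * (q i - p i)))).
  apply: ler_sum => i _; apply: le_trans (limit_increment _ _ l (p0 i) (le_pq i)) _.
  apply: lerD; last by rewrite le_eqVlt; apply/orP; left; apply/eqP; ring.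
  rewrite ler_wpM2r ?limit_cost_ge0// ler_expR.
  by have [] := pq i.
rewrite big_split/= -!mulr_sumr.
have Hc : \sum_(i < m) limit_cost (p i) (q i) <= C.
  by apply: sum_limit_cost_le => //; exact: trivIset_itv_oc.
apply: (@lt_le_trans _ _ (expR T * (C + 1) + A / 4 * l ^+ 2 * (2 * e / (A * l)))).
  rewrite ltr_leD//.
    by rewrite ltr_pM2l ?expR_gt0// (le_lt_trans Hc)// ltrDl.
  by rewrite ler_wpM2l ?(ltW pqd)// mulr_ge0 ?sqr_ge0// divr_ge0// ltW.
rewrite le_eqVlt; apply/orP; left; apply/eqP.
rewrite (_ : expR T * (C + 1) = l * e / 2).
  by field; rewrite !gt_eqF.
by rewrite /l; field; rewrite gt_eqF.
Qed.

(** The minorant is assumed only near [limit_curve s]. By equicontinuity each [eta k] moves less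
    than [r / 2] on a short [[a, b]], and for [U]-most [k] the point [eta k s] is within [r / 2] of
    the limit. Those curves stay in the neighbourhood, and their lower bounds pass to the limit. *)
Lemma limit_cost_lower s p c : 0 < s ->
  (\forall y \near limit_curve s, forall v, dot p v <= L y v + B + c) ->
  exists2 d : R, 0 < d & forall a b, 0 <= a -> a < b -> a <= s -> s <= b -> b - a < d ->
    - dot p (limit_curve b - limit_curve a) <= expR b * limit_cost a b + c * (b - a).
Proof.
move=> s0 /nbhs_ballP[r /= r0 Hr].
(* Since [b <= s + 1], [K] bounds the cost term of every increment inside [[a, b]]. With the choices
   of [l] and of the length below, [l * (r / 2) = K + K], one [K] for each term. *)
pose K := expR (s + 1) * (C + 1).
have K0 : 0 < K by rewrite mulr_gt0 ?expR_gt0//; have := C_ge0; lra.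
pose l := 4 * K / r.
have l0 : 0 < l by rewrite divr_gt0// mulr_gt0.
exists (Num.min 1 (r / (A * l))); first by rewrite lt_min ltr01 divr_gt0// mulr_gt0.
move=> a b a0 ab as_ sb; rewrite lt_min => /andP[ab1 abd].
have incr k t1 t2 : a <= t1 -> t1 <= t2 -> t2 <= b ->
    enorm (eta k t2 - eta k t1) < r / 2.
  move=> at1 t12 t2b; rewrite -(ltr_pM2l l0).
  apply: le_lt_trans (curve_increment k t1 t2 l (le_trans a0 at1) t12) _.
  rewrite (_ : l * (r / 2) = K + A * (r / (A * l)) / 4 * l ^+ 2); last first.
    by rewrite /l; field; rewrite !gt_eqF.
  rewrite ler_ltD//.
    apply: (@le_trans _ _ (expR t2 * (C + 1))).
      by rewrite ler_wpM2l ?expR_ge0 ?cost_on_le// (le_trans a0).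
    by rewrite ler_wpM2r ?ler_expR; have := C_ge0; lra.
  rewrite ltr_pM2r ?exprn_gt0// ltr_pM2r// ltr_pM2l//; lra.
have h2 : expR b * cost_on k a b + c * (b - a) @[k --> U] -->
    expR b * limit_cost a b + c * (b - a).
  by apply: cvgD; [apply: cvgMr; exact: limit_cost_cvg|exact: cvg_cst].
apply: (ler_cvg_to (limit_dot_cvg a b p a0 (ltW ab)) h2).
have r20 : 0 < r / 2 by rewrite divr_gt0.
have /cvg_ballP/(_ _ r20) := limit_curve_cvg_ge0 s (ltW s0).
apply: filterS => k ks; apply: cost_on_lower => // t v at_ tb; apply: Hr.
apply: ball_split ks _; rewrite -ball_normE/=.
(* Balls are those of the sup norm, which the Euclidean norm dominates. *)
apply: le_lt_trans (norm_le_enorm _) _.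
have [st|ts] := leP s t; first by rewrite enorm_distrC; exact: incr.
by apply: incr => //; exact: ltW.
Qed.

End limit_curve.

(** * Lower semicontinuity *)

Lemma le_limn_einf {R : realType} (u : nat -> \bar R) (l : \bar R) :
  (\forall m \near \oo, (l <= u m)%E) -> (l <= limn_einf u)%E.
Proof.
move=> [N _ HN]; rewrite limn_einf_lim.
apply: lime_ge; first exact: is_cvg_einfs.
exists N => // m /= Nm; apply: le_ereal_inf_tmp => _ [i /= mi <-].
by apply: HN => /=; exact: leq_trans mi.
Qed.

Lemma limn_einf_le {R : realType} (u : nat -> \bar R) (l : \bar R) :
  (forall m, (u m <= l)%E) -> (limn_einf u <= l)%E.
Proof.
move=> ul; rewrite limn_einf_lim.
apply: lime_le; first exact: is_cvg_einfs.
apply: nearW => m; apply: le_trans (ul m); apply: ereal_inf_lbound.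
by exists m => /=.
Qed.

(* The difference quotient is taken over intervals that contain the point
   anywhere, not necessarily as an endpoint. *)
Lemma straddled_derivative {R : realType} (f : R -> R) (s l : R) :
  h^-1 *: (f (h + s) - f s) @[h --> 0^'] --> l ->
  forall e, 0 < e -> exists2 d : R, 0 < d & forall a b, a <= s -> s <= b -> b - a < d ->
    `|f b - f a - (b - a) * l| <= e * (b - a).
Proof.
move=> /cvgrPdist_le H e e0; have [d /= d0 Hd] := H e e0.
have one t : `|t - s| < d -> `|f t - f s - (t - s) * l| <= e * `|t - s|.
  have [->|ts] := eqVneq t s; first by rewrite !subrr mul0r subrr normr0 mulr0.
  have ts0 : t - s != 0 by rewrite subr_eq0.
  move=> tsd; have := Hd (t - s); rewrite /= sub0r normrN subrK => /(_ tsd ts0) Hl.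
  have -> : f t - f s - (t - s) * l = - ((t - s) * (l - (t - s)^-1 *: (f t - f s))).
    by rewrite /GRing.scale/=; field.
  by rewrite normrN normrM mulrC ler_pM2r// normr_gt0.
exists d => // a b as_ sb abd.
have -> : f b - f a - (b - a) * l =
  (f b - f s - (b - s) * l) - (f a - f s - (a - s) * l) by ring.
apply: le_trans (ler_normB _ _) _.
have -> : e * (b - a) = e * `|b - s| + e * `|a - s|.
  by rewrite ger0_norm ?subr_ge0// ler0_norm ?subr_le0//; ring.
apply: lerD; apply: one.
  by rewrite ger0_norm ?subr_ge0//; lra.
by rewrite ler0_norm ?subr_le0//; lra.
Qed.

Section lower_semicontinuity.
Context {R : realType} {n : nat}.
Local Notation mu := (@lebesgue_measure R).
Variables (H L : 'rV[R]_n -> 'rV[R]_n -> R) (A B : R).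
Hypothesis cH : continuous (fun z : 'rV[R]_n * 'rV[R]_n => H z.1 z.2).
Hypothesis HL : forall x v, (L x v)%:E = legendre H x v.
Hypothesis cL : continuous (fun z : 'rV[R]_n * 'rV[R]_n => L z.1 z.2).
Hypothesis A0 : 0 < A.
Hypothesis growth : forall x v, A^-1 * enorm v ^+ 2 - B <= L x v <= A * enorm v ^+ 2 + B.
Variables (x : 'rV[R]_n) (eta : nat -> R -> 'rV[R]_n) (C : R) (U : set_system nat).
Hypothesis aeta : forall k, admissible x (eta k).
Hypothesis costeta : forall k,
  (\int[mu]_(s in `]0%R, +oo[) (running_cost L B (eta k) s)%:E <= (C + k.+1%:R^-1)%:E)%E.
Hypothesis UU : UltraFilter U.
Hypothesis Uoo : \oo `<=` U.

Local Notation lc := (limit_curve eta U).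
Local Notation Phi := (limit_cost L B eta U).

Lemma legendre_ge y v p : dot p v - H y p <= L y v.
Proof. by rewrite -lee_fin HL; apply: ereal_sup_ubound; exists p. Qed.

Lemma legendre_adherent y v e : 0 < e -> exists p, L y v - e < dot p v - H y p.
Proof.
move=> e0.
have /ereal_sup_gt[_ [p _ <-]] : ((L y v - e)%:E < legendre H y v)%E.
  by rewrite -HL lte_fin ltrBlDr ltrDl.
by rewrite lte_fin; exists p.
Qed.

(** A single [p], nearly optimal in the supremum defining [L] at [(lc s, - derive1 lc s)], suffices:
    continuity of [H] in its first argument keeps its Fenchel minorant valid near [lc s], and
    differentiability replaces the increment of [lc] by its derivative. *)
Lemma running_cost_le_limit s : 0 < s ->
  h^-1 *: (lc (h + s) - lc s) @[h --> 0^'] --> derive1 lc s ->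
  forall e, 0 < e -> exists2 d : R, 0 < d & forall a b,
    0 <= a -> a < b -> a <= s -> s <= b -> b - a < d ->
    (running_cost L B lc s - e) * (b - a) <= Phi a b.
Proof.
(* The four quarters of [e] pay for the choice of [p], the variation of [H], the difference quotient
   and the variation of the exponential. *)
move=> s0 ds e e0; pose e4 := e / 4; have e40 : 0 < e4 by rewrite /e4; lra.
have [p Lp] := legendre_adherent (lc s) (- derive1 lc s) e4 e40.
have nearH : \forall y \near lc s, forall v, dot p v <= L y v + B + (H (lc s) p + e4 - B).
  have cHp : {for lc s, continuous (fun y => H y p)}.
    apply: (@continuous_comp _ _ _ (fun y => (y, p)) (fun z => H z.1 z.2)); last exact: cH.
    by apply: continuous_pair; [exact: cvg_id|exact: (@cst_continuous _ _ p)].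
  have := @cvgr_lt _ _ _ _ _ _ cHp (H (lc s) p + e4).
  rewrite ltrDl => /(_ _ e40) Hn; apply: filterS Hn => y Hy v.
  by have := legendre_ge y v p; lra.
have [d1 d10 H1] := limit_cost_lower L A B cL A0 growth x eta C U aeta costeta UU Uoo
  s p _ s0 nearH.
have dphi : h^-1 *: (dot p (lc (h + s)) - dot p (lc s)) @[h --> 0^'] -->
    dot p (derive1 lc s).
  under eq_cvg do rewrite -dotBr /GRing.scale/= -dotZr.
  by apply: (@cvg_comp _ _ _ _ (dot p) _ _ _ ds); exact: dot_continuous.
have [d2 d20 H2] := straddled_derivative (fun t => dot p (lc t)) s _ dphi e4 e40.
pose X := dot p (- derive1 lc s) - H (lc s) p + B - e4 - e4.
(* [X] may be negative, so [expR (- b) * X] is compared with [expR (- s) * X] by continuity, not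
   monotonicity. *)
have cX : {for s, continuous (fun b => expR (- b) * X)}.
  apply: cvgM; last exact: cvg_cst.
  by apply: continuous_comp; [exact: cvgN|exact: continuous_expR].
have [d3 d30 H3] : exists2 d, 0 < d & forall b, `|b - s| < d ->
    expR (- s) * X - e4 <= expR (- b) * X.
  have /cvgrPdist_le/(_ e4 e40)[d /= d0 Hd] := cX.
  exists d => // b bd; have := Hd b; rewrite /= distrC => /(_ bd).
  by rewrite ler_norml => /andP[_]; lra.
exists (Num.min d1 (Num.min d2 d3)); first by rewrite !lt_min d10 d20 d30.
move=> a b a0 ab as_ sb; rewrite !lt_min => /and3P[abd1 abd2 abd3].
have ba0 : 0 < b - a by rewrite subr_gt0.
have {H1} := H1 a b a0 ab as_ sb abd1.
have {H2} := H2 a b as_ sb abd2.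
have {H3} : expR (- s) * X - e4 <= expR (- b) * X.
  by apply: H3; rewrite ger0_norm ?subr_ge0//; lra.
move=> H3; rewrite ler_norml => /andP[_ H2] H1.
have step : X * (b - a) <= expR b * Phi a b.
  move: H1 H2; rewrite dotBr /X dotNr; nra.
have {}step : expR (- b) * X * (b - a) <= Phi a b.
  rewrite -mulrA expRN ler_pdivrMl ?expR_gt0//.
apply: le_trans step; rewrite ler_pM2r//; apply: le_trans H3.
(* The first three errors are multiplied by [expR (- s)], which does not enlarge them. *)
have es : expR (- s) <= 1 by rewrite expR_le1 oppr_le0 ltW.
have es0 := expR_ge0 (- s).
have LX : L (lc s) (- derive1 lc s) + B - 3 * e4 <= X by rewrite /X; lra.
rewrite /running_cost (_ : e = 3 * e4 + e4); last by rewrite /e4; field.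
nra.
Qed.

End lower_semicontinuity.

Lemma measurable_fun_limn_einf {d} {X : measurableType d} {R : realType} (D : set X)
    (f : nat -> X -> \bar R) : (forall m, measurable_fun D (f m)) ->
  measurable_fun D (fun x => limn_einf (f ^~ x)).
Proof.
move=> mf.
apply: (@eq_measurable_fun _ _ _ _ D (fun x => - limn_esup (fun m => - f m x))%E).
  move=> x _; rewrite -limn_einfN; congr limn_einf.
  by apply/funext => m /=; rewrite oppeK.
apply: measurableT_comp => //; apply: measurable_fun_limn_esup => m.
exact: measurableT_comp.
Qed.

(** * Dyadic averages on the half-line *)

Section dyadic_average.
Context {R : realType}.
Local Notation mu := (@lebesgue_measure R).
Variable Phi : R -> R -> R.
Hypothesis Phi_ge0 : forall a b, 0 <= a -> 0 <= Phi a b.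

Let term m j (s : R) : \bar R :=
  ((Phi (dyadic 1 m j) (dyadic 1 m j.+1) * 2 ^+ m)%:E * (\1_(dyadic_cell 1 m j) s)%:E)%E.

(** On []0, m]], [Phi] of the level-[m] cell containing [s], divided by the cell length; 0 beyond.
    Mesh and window improve together with [m]. *)
Definition dyadic_average (m : nat) (s : R) : \bar R := (\sum_(j < m * 2 ^ m) term m j s)%E.

Let coef_ge0 m j : 0 <= Phi (dyadic 1 m j) (dyadic 1 m j.+1) * 2 ^+ m.
Proof. by rewrite mulr_ge0 ?Phi_ge0 ?dyadic_ge0// exprn_ge0. Qed.

Let term_ge0 m j s : (0 <= term m j s)%E.
Proof. by rewrite mule_ge0 ?lee_fin ?coef_ge0. Qed.

Let measurable_term m j : measurable_fun setT (term m j).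
Proof.
apply: measurable_funeM; apply/measurable_EFinP; apply: measurable_indic.
exact: measurable_dyadic_cell.
Qed.

Lemma dyadic_average_ge0 m s : (0 <= dyadic_average m s)%E.
Proof. exact: sume_ge0. Qed.

Lemma measurable_dyadic_average m : measurable_fun setT (dyadic_average m).
Proof. by apply: emeasurable_sum => j. Qed.

Lemma integral_dyadic_average m :
  (\int[mu]_(s in `]0%R, +oo[) dyadic_average m s =
   (\sum_(j < m * 2 ^ m) Phi (dyadic 1 m j) (dyadic 1 m j.+1))%:E)%E.
Proof.
rewrite ge0_integral_sum//; last by move=> j; apply: measurable_funTS; exact: measurable_term.
rewrite -sumEFin; apply: eq_bigr => j _.
rewrite ge0_integralZl//; last 2 first.
- by apply/measurable_EFinP; apply: measurable_indic; exact: measurable_dyadic_cell.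
- by rewrite lee_fin coef_ge0.
rewrite integral_indic//; last exact: measurable_dyadic_cell.
rewrite setIidl.
  transitivity ((Phi (dyadic 1 m j) (dyadic 1 m j.+1) * 2 ^+ m)%:E * (1 / 2 ^+ m)%:E)%E.
    by congr (_ * _)%E; exact: lebesgue_dyadic_cell.
  rewrite -EFinM; congr EFin.
  by rewrite mul1r mulfK// expf_neq0.
move=> s; rewrite /dyadic_cell/= !in_itv/= andbT => /andP[+ _].
by apply: le_lt_trans; exact: dyadic_ge0.
Qed.

Lemma dyadic_averageE m s : 0 < s -> s <= m%:R -> exists j,
  [/\ dyadic 1 m j < s, s <= dyadic 1 m j.+1 &
      dyadic_average m s = (Phi (dyadic 1 m j) (dyadic 1 m j.+1) * 2 ^+ m)%:E].
Proof.
move=> s0 sm.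
have mE : dyadic 1 m (m * 2 ^ m) = m%:R :> R.
  by rewrite /dyadic natrM natrX mulrCA divfK ?mulr1// expf_neq0.
have exN : exists N, s <= dyadic 1 m N by exists (m * 2 ^ m)%N; rewrite mE.
(* The least dyadic point not before [s] is the right end of its cell; its index is not 0 because
   [s > 0]. *)
case: (ex_minnP exN) => -[|j] sj minj.
  by move: sj; rewrite /dyadic mulr0 leNgt s0.
have js : dyadic 1 m j < s.
  by rewrite ltNge; apply/negP => /minj; rewrite ltnn.
have jm : (j < m * 2 ^ m)%N.
  by apply: minj; rewrite mE.
exists j; split => //.
have sc : dyadic_cell 1 m j s by rewrite /dyadic_cell/= in_itv/= js.
rewrite /dyadic_average (bigD1 (Ordinal jm))//= [X in (_ + X)%E]big1 ?adde0.
  by rewrite /term indicE mem_set// mule1.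
move=> i ij; rewrite /term indicE memNset ?mule0// => si.
have := trivIset_dyadic_cell 1 m ler01 i j I I (ex_intro _ s (conj si sc)).
by move=> /eqP; rewrite -[_ == _]/(i == Ordinal jm) (negbTE ij).
Qed.

End dyadic_average.

Section lower_semicontinuity.
Context {R : realType} {n : nat}.
Local Notation mu := (@lebesgue_measure R).

(** The densities exist on bounded horizons; the exceptional null sets for the horizons [N.+1] form
    a countable family. *)
Lemma ae_derivable (eta : R -> 'rV[R]_n) : abs_continuous eta ->
  {ae mu, forall s : R, 0 < s ->
    h^-1 *: (eta (h + s) - eta s) @[h --> 0^'] --> derive1 eta s}.
Proof.
move=> ace.
have H N : {ae mu, forall s : R, 0 < s < N.+1%:R ->
    h^-1 *: (eta (h + s) - eta s) @[h --> 0^'] --> derive1 eta s}.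
  have N0 : 0 < N.+1%:R :> R by [].
  have [g [_ _]] := abs_continuous_vector_density eta N.+1%:R ace N0.
  apply: filterS; first exact: (ae_filter_ringOfSetsType mu).
  by move=> s /= Hs /Hs[].
have := ae_foralln H; apply: filterS.
move=> s /= Hs s0; apply: (Hs (Num.truncn s)).
by rewrite s0 truncnS_gt.
Qed.

Variables (H L : 'rV[R]_n -> 'rV[R]_n -> R) (A B : R).
Hypothesis cH : continuous (fun z : 'rV[R]_n * 'rV[R]_n => H z.1 z.2).
Hypothesis HL : forall x v, (L x v)%:E = legendre H x v.
Hypothesis cL : continuous (fun z : 'rV[R]_n * 'rV[R]_n => L z.1 z.2).
Hypothesis A0 : 0 < A.
Hypothesis growth : forall x v, A^-1 * enorm v ^+ 2 - B <= L x v <= A * enorm v ^+ 2 + B.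
Variables (x : 'rV[R]_n) (eta : nat -> R -> 'rV[R]_n) (C : R) (U : set_system nat).
Hypothesis aeta : forall k, admissible x (eta k).
Hypothesis costeta : forall k,
  (\int[mu]_(s in `]0%R, +oo[) (running_cost L B (eta k) s)%:E <= (C + k.+1%:R^-1)%:E)%E.
Hypothesis UU : UltraFilter U.
Hypothesis Uoo : \oo `<=` U.

(** Fatou's lemma for the dyadic averages of [Phi]: their lower limit dominates the running cost
    almost everywhere, and their integrals are sums over disjoint cells, hence at most [C]. *)
Lemma running_cost_limit_curve :
  (\int[mu]_(s in `]0%R, +oo[) (running_cost L B (limit_curve eta U) s)%:E <= C%:E)%E.
Proof.
set lc := limit_curve eta U; pose Phi := limit_cost L B eta U.
have Phi_ge0 a b : 0 <= a -> 0 <= Phi a b.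
  exact: (limit_cost_ge0 L A B cL A0 growth x eta C U aeta costeta UU).
have [ac _] : admissible x lc.
  exact: (admissible_limit_curve L A B cL A0 growth x eta C U aeta costeta UU Uoo).
have LB y v : 0 <= L y v + B by exact: lagrangian_ge0 growth _ _.
apply: (@le_trans _ _ (\int[mu]_(s in `]0%R, +oo[)
    limn_einf (fun m => dyadic_average Phi m s))%E).
  apply: ae_ge0_le_integral => //.
  - by move=> s _; rewrite lee_fin running_cost_ge0.
  - exact: measurable_running_cost.
  - by move=> s _; apply: le_limn_einf; apply: nearW => m; exact: dyadic_average_ge0.
  - apply: measurable_fun_limn_einf => m; apply: measurable_funTS.
    exact: measurable_dyadic_average.
  have := ae_derivable lc ac; apply: filterS; first exact: (ae_filter_ringOfSetsType mu).
  move=> s /= ds; rewrite in_itv/= andbT => s0.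
  apply/lee_subgt0Pr => e e0; rewrite -EFinB.
  have [d d0 Hd] := running_cost_le_limit H L A B cH HL cL A0 growth x eta C U aeta costeta
    UU Uoo s s0 (ds s0) e e0.
  have [m0 Hm0] := exists_dyadic_lt 1 d d0.
  (* From this level on, the mesh is below [d] and [s] lies in the window []0, m]]. *)
  apply: le_limn_einf; exists (maxn m0 (Num.truncn s).+1) => // m /=.
  rewrite geq_max => /andP[m0m sm].
  have {}sm : s <= m%:R.
    by rewrite (le_trans (ltW (truncnS_gt s)))// ler_nat.
  have [j [js sj ->]] := dyadic_averageE Phi m s s0 sm.
  have := Hd (dyadic 1 m j) (dyadic 1 m j.+1) (dyadic_ge0 _ _ _ ler01)
    (lt_le_trans js sj) (ltW js) sj.
  rewrite dyadicS [X in X < d -> _]addrAC subrr add0r => /(_ (Hm0 m m0m)).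
  rewrite addrAC subrr add0r lee_fin mul1r ler_pdivrMr ?exprn_gt0//.
apply: le_trans (fatou mu _ _ _) _ => //.
- by move=> m; apply: measurable_funTS; exact: measurable_dyadic_average.
- by move=> m s _; exact: dyadic_average_ge0.
apply: limn_einf_le => m; rewrite integral_dyadic_average// lee_fin.
apply: (sum_limit_cost_le L A B cL A0 growth x eta C U aeta costeta UU Uoo).
  by move=> i; exact: dyadic_ge0.
by move=> i j _ _ /(trivIset_dyadic_cell 1 m ler01 i j I I) /val_inj.
Qed.

End lower_semicontinuity.

(** * The weighted speed and the conclusion *)

Section weighted_speed.
Context {R : realType} {n : nat}.
Local Notation mu := (@lebesgue_measure R).

Lemma weighted_speedE (eta : R -> 'rV[R]_n) : (weighted_speed eta =
  (\int[mu]_(s in `]0%R, +oo[) (expR (- s) * enorm (derive1 eta s) ^+ 2)%:E) `^ 2^-1)%E.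
Proof.
rewrite /weighted_speed unlock [in RHS]integral_mkcond.
congr (_ `^ _)%E; apply: eq_integral => s _.
rewrite /= !patchE; case: ifPn => _; last by rewrite normr0 powR0.
rewrite powR_mulrn// real_normK ?num_real// exprMn; congr (_ * _)%:E.
by rewrite expr2 -expRD -splitr.
Qed.

(** The growth bound [enorm v ^+ 2 <= A * (L x v + B)], weighted by [expR (- s)] and integrated,
    bounds the squared norm by [A * C]. *)
Lemma weighted_speed_le (L : 'rV[R]_n -> 'rV[R]_n -> R) (A B C : R) (eta : R -> 'rV[R]_n) :
  continuous (fun z : 'rV[R]_n * 'rV[R]_n => L z.1 z.2) -> 0 < A ->
  (forall x v, A^-1 * enorm v ^+ 2 - B <= L x v <= A * enorm v ^+ 2 + B) ->
  abs_continuous eta ->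
  (\int[mu]_(s in `]0%R, +oo[) (running_cost L B eta s)%:E <= C%:E)%E ->
  (weighted_speed eta <= ((A * C) `^ 2^-1)%:E)%E.
Proof.
move=> cL A0 growth ac costC; have LB := lagrangian_ge0 L A B A0 growth.
rewrite weighted_speedE -poweR_EFin.
set I := (\int[mu]_(s in _) _)%E.
have I0 : (0 <= I)%E.
  by apply: integral_ge0 => s _; rewrite lee_fin mulr_ge0 ?expR_ge0 ?sqr_ge0.
suff IAC : (I <= (A * C)%:E)%E.
  apply: gt0_ler_poweR => //; rewrite in_itv/= leey andbT//.
  exact: le_trans IAC.
apply: (@le_trans _ _ (A%:E * \int[mu]_(s in `]0%R, +oo[) (running_cost L B eta s)%:E)%E).
  rewrite -ge0_integralZl//; last 3 first.
  - exact: measurable_running_cost.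
  - by move=> s _; rewrite lee_fin running_cost_ge0.
  - by rewrite lee_fin ltW.
  apply: ge0_le_integral => //.
  - by move=> s _; rewrite lee_fin mulr_ge0 ?expR_ge0 ?sqr_ge0.
  - apply/measurable_EFinP.
    apply: (measurable_fun_derive1_gt0 _ (fun s _ v => expR (- s) * enorm v ^+ 2) ac).
    move=> [[s x] v]; apply: cvgM.
      apply: (@continuous_comp _ _ _ (fun z : R * 'rV[R]_n * 'rV[R]_n => - z.1.1) expR).
        apply: cvgN; apply: (@continuous_comp _ _ _ fst fst).
          by apply: (@cvg_fst _ _ (nbhs (s, x)) (nbhs v)).
        by apply: (@cvg_fst _ _ (nbhs s) (nbhs x)).
      exact: continuous_expR.
    apply: (@continuous_comp _ _ _ snd (fun v => enorm v ^+ 2)).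
      by apply: (@cvg_snd _ _ (nbhs (s, x)) (nbhs v)).
    by apply: (@continuous_comp _ _ _ (@enorm R n) (fun r => r ^+ 2));
      [exact: enorm_continuous|exact: exprn_continuous].
  - by apply: measurable_funeM; exact: measurable_running_cost.
  move=> s _; rewrite -EFinM lee_fin /running_cost [leRHS]mulrCA ler_wpM2l ?expR_ge0//.
  rewrite -ler_pdivrMl//; have /andP[+ _] := growth (eta s) (- derive1 eta s).
  rewrite (_ : enorm (- derive1 eta s) = enorm (derive1 eta s)); first by lra.
  by rewrite -[in LHS]sub0r enorm_distrC subr0.
by rewrite EFinM lee_pmul2l.
Qed.

End weighted_speed.

Theorem theorem5p7 (R : realType) :
  exists C4 : R -> R -> R -> R,
  forall (n : nat) (H L : 'rV[R]_n -> 'rV[R]_n -> R) (A B CH : R),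
    hamiltonian H ->
    (forall x v, (L x v)%:E = legendre H x v) ->
    continuous (fun z : 'rV[R]_n * 'rV[R]_n => L z.1 z.2) ->
    (forall x, convex_function setT (L x)) ->
    0 < A -> 0 < B ->
    (forall x v, A^-1 * enorm v ^+ 2 - B <= L x v <= A * enorm v ^+ 2 + B) ->
    continuously_differentiable L ->
    0 < CH ->
    lipschitz (value L) ->
    (Linfty_norm (value L) +
       Linfty_norm (fun x => enorm (gradient (value L) x)) <= CH%:E)%E ->
  forall x : 'rV[R]_n, exists eta : R -> 'rV[R]_n,
    [/\ admissible x eta,
        action L eta = (value L x)%:E
      & (weighted_speed eta <= (C4 CH A B)%:E)%E].
Proof.
(* The limit curve has total running cost at most [value L x + B <= B + B], which
   [weighted_speed_le] turns into this constant. *)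
exists (fun _ A B => (A * (B + B)) `^ 2^-1) => n H L A B CH [cH _ _ _ _ _] HL cL _ A0 B0 growth.
move=> _ _ _ _ x.
have [eta Heta] := minimizing_sequence L A B cL A0 B0 growth x.
have aeta k := proj1 (Heta k); have costeta k := proj2 (Heta k).
have [U [UU Uoo]] := @ultraFilterLemma nat \oo _.
have alc := admissible_limit_curve L A B cL A0 growth x eta _ U aeta costeta UU Uoo.
have costlc := running_cost_limit_curve H L A B cH HL cL A0 growth x eta _ U aeta costeta UU Uoo.
have [ac _] := alc.
exists (limit_curve eta U); split => //.
  (* One inequality is the definition of the infimum; the other is the cost bound after removing the
     shift [B]. *)
  apply/eqP; rewrite eq_le (value_le_action L A B)// andbT.
  by rewrite -(leeD2rE (x := B%:E))// (action_running_cost L A B).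
apply: (weighted_speed_le L A B (B + B)) => //.
apply: le_trans costlc _; rewrite lee_fin lerD2r.
exact: (value_le L A B cL A0 B0 growth x).
Qed.
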